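(* Let $A$, $W_1$, $W_2$, $\overline W$, the observation $M_\varepsilon$, the posterior distribution $\Pi(\cdot\,|\,M_\varepsilon)$ and the notion of weak convergence in probability be as described in the context. Let $f^\dagger\in\overline W$ be fixed and let $P^M_{f^\dagger}$ be the law of $M_\varepsilon=Af^\dagger+\varepsilon\mathbb W$. Let $\Pi$ be a centred Gaussian Borel probability measure on $\overline W$, with RKHS $V_\Pi$, that satisfies the concentration condition (stated in the context) for $f^\dagger$. Let $\bar f=\mathbb E^\Pi[f\,|\,M_\varepsilon]$ be the mean of the posterior $\Pi(\cdot\,|\,M_\varepsilon)$. Then, for every $\psi\in W_1$ such that $|\langle\psi,\varphi\rangle_{W_1}|\le C\|\varphi\|_{\overline W}$ for all $\varphi\in W_1$ (for some constant $C>0$) and $\psi=-A^*A\widetilde\psi$ for some $\widetilde\psi\in V_\Pi$, setting $$\widehat\Psi=\langle f^\dagger,\psi\rangle_{W_1}-\varepsilon\langle A\widetilde\psi,\mathbb W\rangle_{W_2},$$ one has $$\frac1\varepsilon\big(\langle\bar f,\psi\rangle_{W_1}-\widehat\Psi\big)\to0$$ in $P^M_{f^\dagger}$-probability as $\varepsilon\to0$. As a consequence, for $f\sim\Pi(\cdot\,|\,M_\varepsilon)$, $$\mathcal L\big(\varepsilon^{-1}(\langle f,\psi\rangle_{W_1}-\langle\bar f,\psi\rangle_{W_1})\,\big|\,M_\varepsilon\big)\to^{\mathcal L}\mathcal N\big(0,\|A\widetilde\psi\|^2_{W_2}\big)$$ in $P^M_{f^\dagger}$-probability as $\varepsilon\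to0$.
   Context: Setting. $W_1,W_2$ are separable Hilbert spaces of real-valued functions, and $A:W_1\to W_2$ is linear, bounded and injective, with adjoint $A^*:W_2\to W_1$, $\langle Af,g\rangle_{W_2}=\langle f,A^*g\rangle_{W_1}$. $\overline W$ is a separable Hilbert space with $W_1\subset\overline W$ dense in the norm of $\overline W$, such that $A:\overline W\to W_2$ is (defined and) continuous; in particular there is $c>0$ with $\|Af\|_{W_2}\le c\|f\|_{\overline W}$ for all $f\in\overline W$. Noise and observation. $\mathbb W=(\mathbb W(\varphi):\varphi\in W_2)$ is a centred Gaussian white noise process with $\mathbb E(\mathbb W(\varphi)\mathbb W(\varphi'))=\langle\varphi,\varphi'\rangle_{W_2}$; we write $\langle\mathbb W,\varphi\rangle_{W_2}=\mathbb W(\varphi)$. For $\varepsilon>0$ the observation is $M_\varepsilon=Af+\varepsilon\mathbb W$, i.e. the Gaussian process $(\langle M_\varepsilon,\varphi\rangle_{W_2}=\langle Af,\varphi\rangle_{W_2}+\varepsilon\mathbb W(\varphi):\varphi\in W_2)$; its law is $P^M_f$. Posterior. For a prior $\Pi$ on $\overline W$, with $p_f(M_\varepsilon)=\exp\{\varepsilon^{-2}\langle M_\varepsilon,Af\rangle_{W_2}-\tfrac12\varepsilon^{-2}\|Af\|_{W_2}^2\}$ the density of $P_f^M$ with respect to $P_0^M$, the posterior is $\Pi(B\,|\,M_\varepsilon)=\int_B p_f(M_\varepsilon)\,d\Pi(f)\big/\int_{\overline W}p_f(M_\varepsilon)\,d\Pi(f)$ for Borel $B\subseteq\overline W$. Concentration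 condition for $\Pi$ and $f^\dagger$. Define, for $\delta>0$, $$\phi_{\Pi,f^\dagger}(\delta)=\inf_{g\in V_\Pi,\ \|g-f^\dagger\|_{\overline W}\le\delta}\frac{\|g\|_{V_\Pi}^2}{2}-\log\Pi(f:\|f\|_{\overline W}\le\delta).$$ The condition is: there exists a sequence $\delta_\varepsilon\to0$ with $\delta_\varepsilon/\varepsilon\to\infty$ as $\varepsilon\to0$ such that $\phi_{\Pi,f^\dagger}(\delta_\varepsilon/(2c))\le(\delta_\varepsilon/\varepsilon)^2$. Conventions. For $\psi$ as in the claim, the functional $\langle\cdot,\psi\rangle_{W_1}$ is extended continuously from $W_1$ to $\overline W$, and $\langle f,\psi\rangle_{W_1}$ for $f\in\overline W$ denotes this extension. $\mathcal L(\cdot\,|\,M_\varepsilon)$ denotes the law under the posterior. For random laws, $\mu_\varepsilon\to^{\mathcal L}\mu$ in probability means that for any metric $d$ for weak convergence of probability measures, $d(\mu_\varepsilon,\mu)\to0$ in probability. *)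

(* Defs.v *)
From HB Require Import structures.
From mathcomp Require Import all_boot all_order all_algebra.
From mathcomp Require Import all_classical all_reals all_analysis.
From mathcomp Require Import measurable_realfun.
Import Order.TTheory GRing.Theory Num.Theory.
Import numFieldTopology.Exports numFieldNormedType.Exports.

Set Implicit Arguments.
Unset Strict Implicit.
Unset Printing Implicit Defensive.

Local Open Scope classical_set_scope.
Local Open Scope ring_scope.

(* Real Hilbert spaces: complete normed modules whose norm comes from an inner
   product.  Positive definiteness is a consequence of [inner_sqnorm]. *)
HB.mixin Record NormedModule_isHilbert (R : realType) V of NormedModule R V := {
  inner : V -> V -> R ;
  innerC : forall f g, inner f g = inner g f ;
  innerDl : forall f g h, inner (f + g) h = inner f h + inner g h ;
  innerZl : forall (a : R) f g, inner (a *: f) g = a * inner f g ;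
  inner_sqnorm : forall f, inner f f = `|f| ^+ 2 }.

#[short(type="hilbertType")]
HB.structure Definition Hilbert (R : realType) :=
  { V of CompleteNormedModule R V & NormedModule_isHilbert R V }.

Definition separable (T : topologicalType) :=
  exists D : set T, countable D /\ dense D.

Definition borel (T : ptopologicalType) := g_sigma_algebraType (@open T).

Section measures.
Context d (T : measurableType d) (R : realType).

Section density.
Local Open Scope ereal_scope.
Variables (mu : {measure set T -> \bar R}) (p : T -> R).

(* The measure p.mu.  The guard only makes this a measure for every [p]. *)
Definition density_measure (B : set T) : \bar R :=
  if pselect (measurable_fun setT p /\ forall x, (0 <= p x)%R)
  then \int[mu]_(x in B) (p x)%:E else 0.

Let density0 : density_measure set0 = 0.
Proof.
by rewrite /density_measure; case: pselect => //= _; rewrite integral_set0.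
Qed.

Let density_ge0 B : 0 <= density_measure B.
Proof.
rewrite /density_measure; case: pselect => //= -[_ p0].
by apply: integral_ge0 => x _; rewrite lee_fin.
Qed.

Let density_sigma_additive : semi_sigma_additive density_measure.
Proof.
rewrite /density_measure; case: pselect => [[mp p0]|_] /=; last first.
  move=> F _ _ _; rewrite [X in X @ \oo --> _](_ : _ = cst 0); first exact: cvg_cst.
  by apply/funext => n; rewrite big1.
move=> F mF tF mUF; rewrite ge0_integral_bigcup//=; last 2 first.
- by apply: measurable_funTS; exact/measurable_EFinP.
- by move=> x _; rewrite lee_fin.
apply: is_cvg_ereal_nneg_natsum_cond => n _ _.
by apply: integral_ge0 => x _; rewrite lee_fin.
Qed.

HB.instance Definition _ := isMeasure.Build _ _ _ density_measure
  density0 density_ge0 density_sigma_additive.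

End density.

(* The law of [X] under [mu]; the guard only makes it a probability for every
   [X]. *)
Definition law (mu : probability T R) (X : T -> measurableTypeR R) :
    probability (measurableTypeR R) R :=
  if pselect (measurable_fun setT X) is left mX
  then (distribution mu (mfun_Sub (mem_set mX)) :
          probability (measurableTypeR R) R)
  else (dirac (0 : measurableTypeR R) : probability (measurableTypeR R) R).

End measures.

(* N(0, s ^+ 2); the case split is needed because [normal_prob 0 0] is not the
   Dirac mass. *)
Definition centered_normal (R : realType) (s : R) :
    probability (measurableTypeR R) R :=
  if s == 0
  then (dirac (0 : measurableTypeR R) : probability (measurableTypeR R) R)
  else (normal_prob 0 s : probability (measurableTypeR R) R).

Section weak_convergence.
Variable R : realType.
Implicit Types mu nu : probability (measurableTypeR R) R.

Definition weak_cvg (u : nat -> probability (measurableTypeR R) R) mu :=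
  forall g : R -> R, continuous g -> (exists K, forall x, `|g x| <= K) ->
    (\int[u n]_x (g x)%:E)%E @[n --> \oo] --> (\int[mu]_x (g x)%:E)%E.

(* Two probabilities are identified when they agree on the measurable sets: the
   type [probability] also records values on the other sets. *)
Definition weak_metric
    (dist : probability (measurableTypeR R) R ->
            probability (measurableTypeR R) R -> R) :=
  [/\ forall mu nu, 0 <= dist mu nu,
      forall mu nu, dist mu nu = 0 <-> (forall B, measurable B -> mu B = nu B),
      forall mu nu, dist mu nu = dist nu mu,
      forall mu nu ka, dist mu ka <= dist mu nu + dist nu ka &
      forall (u : nat -> probability (measurableTypeR R) R) mu,
        (dist (u n) mu @[n --> \oo] --> (0 : R)) <-> weak_cvg u mu].

End weak_convergence.

(* Convergence to 0 in probability as eps -> 0+.  The outer measure [mu_ext P]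
   is [P] on events, so this is the usual notion for random variables, and it
   makes sense without checking the measurability of [X eps]. *)
Definition cvg0_in_probability d (Omega : measurableType d) (R : realType)
    (P : probability Omega R) (X : R -> Omega -> R) :=
  forall eta : R, 0 < eta ->
    mu_ext P [set w | eta <= `|X eps w|] @[eps --> 0^'+] --> 0%E.

Section gaussian_measures.
Variables (R : realType) (V : hilbertType R).
Implicit Types (mu : probability (borel V) R) (f g h m : V) (k : V -> R).

Definition gaussian_centered mu :=
  forall h, exists s : R, forall B : set (measurableTypeR R), measurable B ->
    mu ((fun f => inner f h) @^-1` B) = centered_normal s B.

(* [m] is the mean of a law with finite first moment: its (weak, hence Bochner)
   integral of the identity. *)
Definition is_mean mu m :=
  (\int[mu]_f (`|(f : V)|)%:E < +oo)%E /\
  forall h, (\int[mu]_f (inner (f : V) h)%:E)%E = (inner m h)%:E.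

Definition mean mu : V := xget 0 [set m | is_mean mu m].

(* The closure in L^2(mu) of the continuous linear functionals, which are the
   [inner ^~ h]. *)
Definition L2_dual mu k :=
  [/\ measurable_fun [set: borel V] k,
      (\int[mu]_f (k f ^+ 2)%:E < +oo)%E &
      forall eta : R, 0 < eta -> exists h,
        (\int[mu]_f ((k f - inner (f : V) h) ^+ 2)%:E <= eta%:E)%E].

(* [g] is the (weak) integral of [k f *: f] under [mu].  The RKHS is the image
   of [L2_dual mu] under [k |-> g], with the norm of L^2(mu) transported. *)
Definition rkhs_repr mu k g :=
  L2_dual mu k /\
  forall h, (\int[mu]_f (k f * inner (f : V) h)%:E)%E = (inner g h)%:E.

Definition rkhs mu : set V := [set g | exists k, rkhs_repr mu k g].

(* All representers [k] of [g] agree almost everywhere, so for [g] in the RKHS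
   this is the infimum of a singleton. *)
Definition rkhs_sqnorm mu g : \bar R :=
  ereal_inf [set (\int[mu]_f (k f ^+ 2)%:E)%E | k in [set k | rkhs_repr mu k g]].

Definition concentration_fun mu f0 (delta : R) : \bar R :=
  (ereal_inf [set rkhs_sqnorm mu g * (2^-1)%:E
             | g in rkhs mu `&` [set g | `|g - f0| <= delta]%R]
   - lne (mu [set f : borel V | `|(f : V)| <= delta]%R))%E.

Definition concentration_condition mu f0 (c : R) :=
  exists delta : R -> R,
    [/\ delta eps @[eps --> 0^'+] --> (0 : R),
        delta eps / eps @[eps --> 0^'+] --> +oo &
        \forall eps \near 0^'+,
          (concentration_fun mu f0 (delta eps / (2 * c))
             <= ((delta eps / eps) ^+ 2)%:E)%E].

End gaussian_measures.

Definition white_noise d (Omega : measurableType d) (R : realType)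
    (P : probability Omega R) (V : hilbertType R) (W : V -> {RV P >-> R}) :=
  (forall n (phi : 'I_n -> V) (a : 'I_n -> R), exists s : R,
     forall B : set (measurableTypeR R), measurable B ->
       P ((fun w => \sum_(i < n) a i * W (phi i) w) @^-1` B)
         = centered_normal s B) /\
  (forall phi phi' : V,
     ('E_P[(fun w => W phi w * W phi' w)%R] = (inner phi phi')%:E)%E).

(* The functional [inner ^~ psi] on [V], extended by continuity to the space
   [Vb] in which [V] is densely included by [iota]. *)
Definition inner_ext (R : realType) (V Vb : hilbertType R) (iota : V -> Vb)
    (psi : V) : Vb -> R :=
  xget (cst 0) [set L : Vb -> R |
    continuous L /\ forall phi, L (iota phi) = inner phi psi].

Section inverse_problem.
Context d (Omega : measurableType d) (R : realType) (P : probability Omega R).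
Variables (V2 Vb : hilbertType R) (A : Vb -> V2) (W : V2 -> {RV P >-> R}).

Definition observation (f0 : Vb) (eps : R) (w : Omega) : V2 -> R :=
  fun phi => inner (A f0) phi + eps * W phi w.

(* Density of the law of the observation under f with respect to f = 0,
   evaluated at the observed process [M]. *)
Definition likelihood (eps : R) (M : V2 -> R) (f : Vb) : R :=
  expR (eps ^- 2 * M (A f) - 2^-1 * eps ^- 2 * `|A f| ^+ 2).

(* The white noise is determined up to a null set for each index separately,
   so for a fixed outcome the likelihood need not be measurable in f.  As usual
   it is replaced by a version that is jointly measurable; two such versions
   give almost surely the same posterior, by Fubini. *)
Definition likelihood_version (f0 : Vb) (p : R -> Vb -> Omega -> R) :=
  forall eps, 0 < eps ->
    [/\ measurable_fun [set: borel Vb * Omega] (fun x => p eps x.1 x.2),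
        forall f w, 0 <= p eps f w &
        forall f, {ae P, forall w,
          p eps f w = likelihood eps (observation f0 eps w) f}].

(* Bayes' formula; the prior is only a default value for outcomes where the
   normalizing constant is 0 or +oo. *)
Definition posterior (Pi : probability (borel Vb) R) (p : R -> Vb -> Omega -> R)
    (eps : R) (w : Omega) : probability (borel Vb) R :=
  mnormalize (density_measure Pi (fun f : borel Vb => p eps f w)) Pi.

End inverse_problem.

(* Main.v *)
(* Let Q be the covariance operator of Pi, T the forward map and g = T psit.  For
   y = (T Q T* + eps^2)^-1 g and v = Q T* y one has g = T v + eps^2 y.  Shifting
   the argument of the likelihood by a multiple of v and undoing the shift with
   the Cameron-Martin formula gives the exponential moments of f |-> <T f, g>
   under the posterior; hence this functional is normal with mean <M, T v> and
   variance |g|^2 - eps^2 <y, g>.  Thus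
     eps^-1 (<fbar, psi> - Psihat) = eps <T f0, y> + eps^2 W(y)  almost surely.
   As psit is in the RKHS, eps |y| stays bounded, so the noise term tends to 0 in
   L^2 and the variance tends to |g|^2.  The bias eps <T f0, y> is O(eps) for f0
   in the RKHS, and the concentration condition puts f0 in its closure. *)
Require Import Defs.
From HB Require Import structures.
From mathcomp Require Import all_boot all_order all_algebra.
From mathcomp Require Import all_classical all_reals all_analysis.
From mathcomp Require Import measurable_realfun ring lra.
Import Order.TTheory GRing.Theory Num.Theory.
Import numFieldTopology.Exports numFieldNormedType.Exports.

Set Implicit Arguments.
Unset Strict Implicit.
Unset Printing Implicit Defensive.

Local Open Scope classical_set_scope.
Local Open Scope ring_scope.

(** * Integrals with respect to a density *)

(** The argument runs on real exponential moments because these are what Bayes' formula produces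
    under a shift. They determine a finite measure, but exponentials are unbounded, so uniqueness is
    proved by passing, through dominated limits, from exponentials to powers, then to sines, then to
    indicators of half-spaces. This is used twice: for the Cameron-Martin formula on the space of
    the prior, and for the normal law of the posterior functional on the line.

    The vector [y] is dictated by an exact cancellation. A shift of the likelihood by [s eps^2 v]
    removes the term [s <T f, T v>] from the exponent on one side; on the other side the
    Cameron-Martin density contributes [s eps^2 <T f, y>], which completes [s <T f, T v>] to
    [s <T f, g>].

    The obstacle is null sets. The noise is linear, and the likelihood is given by its formula, only
    almost surely for each fixed argument. Tonelli converts this into identities valid for almost
    every outcome and prior-almost every [f], and rational exponents let one null set serve all
    moments. *)

Section density_integral.
Local Open Scope ereal_scope.
Context d (T : measurableType d) (R : realType).
Variables (mu nu : {measure set T -> \bar R}) (p : T -> R).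
Hypothesis mp : measurable_fun setT p.
Hypothesis p0 : forall x, (0 <= p x)%R.
Hypothesis nuE : forall B, measurable B -> nu B = \int[mu]_(x in B) (p x)%:E.

Import HBNNSimple.

Let integral_density_nnsfun (h : {nnsfun T >-> R}) :
  \int[nu]_x (h x)%:E = \int[mu]_x ((h x)%:E * (p x)%:E).
Proof.
have mI (r : R) : measurable_fun [set: T] (fun x => (\1_(h @^-1` [set r]) x)%:E : \bar R).
  exact/measurable_EFinP/measurable_indic/measurable_sfunP.
have mpE : measurable_fun [set: T] (EFin \o p) by exact/measurable_EFinP.
rewrite integralT_nnsfun sintegralE.
under [RHS]eq_integral.
  move=> x _; rewrite fimfunE -fsumEFin// ge0_mule_fsuml; last first.
    by move=> r; rewrite EFinM nnfun_muleindic_ge0.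
  over.
rewrite ge0_integral_fsum//; last 2 first.
- move=> r; apply: emeasurable_funM => //.
  by apply/measurable_EFinP; apply: measurable_funM => //;
    exact/measurable_indic/measurable_sfunP.
- by move=> r x _; apply: mule_ge0; [rewrite EFinM nnfun_muleindic_ge0|rewrite lee_fin].
apply: eq_fsbigr => r _.
have [r0|r0] := ltP r 0%R.
  rewrite preimage_nnfun0// measure0 mule0.
  rewrite integral0_eq// => x _.
  by rewrite indicE in_set0 mulr0 mul0e.
under [RHS]eq_integral do rewrite EFinM -muleA.
rewrite ge0_integralZl//; last 2 first.
- exact: emeasurable_funM.
- by move=> x _; rewrite mule_ge0 ?lee_fin.
congr (_ * _); rewrite nuE; last exact: measurable_sfunP.
rewrite [LHS]integral_mkcond; apply: eq_integral => x _.
by rewrite patchE indicE; case: ifP => _ /=; rewrite ?mul1e ?mul0e.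
Qed.

(** Monotone approximation by simple functions. [nu] is any measure with these values on measurable
    sets, so that the formula covers [density_measure], the normal law and the normalized posterior
    alike. *)
Lemma ge0_integral_density (F : T -> \bar R) : measurable_fun setT F ->
  (forall x, 0 <= F x) -> \int[nu]_x F x = \int[mu]_x (F x * (p x)%:E).
Proof.
move=> mF F0; pose f_ := nnsfun_approx measurableT mF.
have cvf x : (f_ n x)%:E @[n --> \oo] --> F x.
  exact: (@cvg_nnsfun_approx _ _ _ _ measurableT _ mF).
have mfn n : measurable_fun [set: T] (fun x => (f_ n x)%:E).
  exact/measurable_EFinP.
transitivity (limn (fun n => \int[nu]_x (f_ n x)%:E)).
  rewrite -monotone_convergence//=.
  - by apply: eq_integral => x _; apply/esym/cvg_lim.
  - by move=> n x _; rewrite lee_fin.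
  - by move=> x _ a b ab; rewrite lee_fin//; exact/lefP/nd_nnsfun_approx.
transitivity (limn (fun n => \int[mu]_x ((f_ n x)%:E * (p x)%:E))).
  by congr (limn _); apply/funext => n; exact: integral_density_nnsfun.
rewrite -monotone_convergence//=.
- apply: eq_integral => x _; apply/cvg_lim => //.
  by apply: cvgeZr.
- by move=> n; apply: emeasurable_funM => //; exact/measurable_EFinP.
- by move=> n x _; rewrite -EFinM lee_fin mulr_ge0.
- move=> x _ a b ab; rewrite -!EFinM lee_fin ler_wpM2r//.
  exact/lefP/nd_nnsfun_approx.
Qed.

End density_integral.

(** Integrability is bundled with the equality so that the class is a vector space and is stable
    under dominated limits. *)
Definition eq_int d (T : measurableType d) (R : realType)
    (mu nu : {measure set T -> \bar R}) (F : T -> R) :=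
  [/\ mu.-integrable setT (EFin \o F), nu.-integrable setT (EFin \o F) &
      (\int[mu]_x (F x)%:E = \int[nu]_x (F x)%:E)%E].

Section eq_int_theory.
Context d (T : measurableType d) (R : realType).
Variables (mu nu : {measure set T -> \bar R}).
Local Notation eqi := (eq_int mu nu).

Lemma eq_intD F G : eqi F -> eqi G -> eqi (fun x => F x + G x).
Proof.
move=> [F1 F2 F3] [G1 G2 G3]; split.
- exact: (integrableD measurableT F1 G1).
- exact: (integrableD measurableT F2 G2).
- rewrite (integralD_EFin measurableT F1 G1) (integralD_EFin measurableT F2 G2).
  by rewrite F3 G3.
Qed.

Lemma eq_intZ (c : R) F : eqi F -> eqi (fun x => c * F x).
Proof.
move=> [F1 F2 F3]; split.
- exact: (integrableZl measurableT c F1).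
- exact: (integrableZl measurableT c F2).
- have e (m : {measure set T -> \bar R}) : m.-integrable setT (EFin \o F) ->
    (\int[m]_x (c * F x)%:E = c%:E * \int[m]_x (F x)%:E)%E.
    by move=> mF; rewrite -(integralZl measurableT mF); apply: eq_integral.
  by rewrite !e// F3.
Qed.

Lemma eq_int0 : eqi (fun=> 0).
Proof. by split; [exact: integrable0|exact: integrable0|rewrite !integral0]. Qed.

Lemma eq_intB F G : eqi F -> eqi G -> eqi (fun x => F x - G x).
Proof.
move=> hF hG; rewrite (_ : (fun _ => _) = (fun x => F x + -1 * G x)).
  by apply: eq_intD => //; exact: eq_intZ.
by apply/funext => x; rewrite mulN1r.
Qed.

Lemma eq_int_sum (I : Type) (s : seq I) (F : I -> T -> R) :
  (forall i, eqi (F i)) -> eqi (fun x => \sum_(i <- s) F i x).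
Proof.
move=> hF; elim: s => [|i s ih].
  by rewrite (_ : (fun _ => _) = fun=> 0) ?funeqE; [exact: eq_int0|move=> x; rewrite big_nil].
rewrite (_ : (fun _ => _) = fun x => F i x + \sum_(j <- s) F j x).
  exact: eq_intD.
by apply/funext => x; rewrite big_cons.
Qed.

Lemma eq_int_lim (F_ : nat -> T -> R) (F D : T -> R) : (forall n, eqi (F_ n)) ->
  (forall x, F_ n x @[n --> \oo] --> F x) ->
  (forall n x, `|F_ n x| <= D x) ->
  mu.-integrable setT (EFin \o D) -> nu.-integrable setT (EFin \o D) -> eqi F.
Proof.
move=> hF cF dF muD nuD.
have mFn n : measurable_fun setT (F_ n).
  by have [/measurable_int/measurable_EFinP] := hF n.
have mF : measurable_fun setT F by apply: (measurable_fun_cvg mFn) => x _; exact: cF.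
have dom (m : {measure set T -> \bar R}) : m.-integrable setT (EFin \o D) ->
    m.-integrable setT (EFin \o F) /\
    (\int[m]_x (F_ n x)%:E @[n --> \oo] --> \int[m]_x (F x)%:E)%E.
  move=> mD.
  have [|||||//] := @dominated_convergence _ _ _ m setT measurableT
      (fun n x => (F_ n x)%:E) (EFin \o F) (EFin \o D).
  - by move=> n; exact/measurable_EFinP.
  - exact/measurable_EFinP.
  - by apply/aeW => x _; apply/cvg_EFin; [exact: nearW|exact: cF].
  - by [].
  - by apply/aeW => x n _ /=; rewrite lee_fin.
have [iF1 c1] := dom mu muD; have [iF2 c2] := dom nu nuD; split=> //.
apply: (@cvg_unique _ (@ereal_hausdorff R) _ _ _ _ c1).
apply: cvg_trans c2; apply: near_eq_cvg; apply: nearW => n.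
by have [_ _ ->] := hF n.
Qed.

End eq_int_theory.

(** * Elementary bounds and limits for exponentials and sines *)

Section exp_bounds.
Context {R : realType}.
Implicit Types x y : R.

Lemma expR_le_1DMexpR x : expR x <= 1 + x * expR x.
Proof.
have := expR_ge1Dx (- x); rewrite -(ler_pM2r (expR_gt0 x)) mulrDl mul1r mulNr.
by rewrite [expR (- x) * _]mulrC expRxMexpNx_1 lerBlDr.
Qed.

Lemma norm_expRB1 x : `|expR x - 1| <= `|x| * expR `|x|.
Proof.
have [x0|x0] := leP 0 x.
  rewrite !ger0_norm// ?lerBlDl ?expR_le_1DMexpR//.
  by rewrite subr_ge0 -expR0 ler_expR.
rewrite !ltr0_norm// ?subr_lt0 ?expR_lt1// opprB.
apply: (@le_trans _ _ (- x)); first by rewrite lerBlDr addrC -lerBlDr opprK expR_ge1Dx.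
by rewrite ler_peMr ?oppr_ge0 ?(ltW x0)// ltW// expR_gt1 oppr_gt0.
Qed.

Lemma normr_le_expR x : `|x| <= expR `|x|.
Proof. by apply: le_trans (expR_ge1Dx _); rewrite lerDr. Qed.

Lemma expR_norm_le x : expR `|x| <= expR x + expR (- x).
Proof.
by case: (ger0P x) => _; rewrite ?lerDl ?lerDr expR_ge0.
Qed.

(** The derivative of the exponential at 0 as a difference quotient: it extracts a factor [x] from
    differences of exponentials, which is how polynomial moments are reached later. *)
Lemma cvg_natZ_expR_divnB1 x :
  n.+1%:R * (expR (x / n.+1%:R) - 1) @[n --> \oo] --> x.
Proof.
have cv : x * expR (x / n.+1%:R) @[n --> \oo] --> x.
  suff : x * expR (x / n.+1%:R) @[n --> \oo] --> x * expR (x * 0).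
    by rewrite mulr0 expR0 mulr1.
  apply: cvgM; first exact: cvg_cst.
  apply: (cvg_comp (fun n => x / n.+1%:R)); last exact: continuous_expR.
  by apply: cvgM; [exact: cvg_cst|exact: cvg_harmonic].
apply: (squeeze_cvgr _ (cvg_cst x) cv); apply: nearW => n.
have n0 : 0 < n.+1%:R :> R by rewrite ltr0n.
apply/andP; split.
  rewrite -ler_pdivrMl// mulrC lerBrDl; exact: expR_ge1Dx.
have := expR_le_1DMexpR (x / n.+1%:R); rewrite -lerBlDl -(ler_pM2l n0).
by rewrite mulrA (mulrC n.+1%:R (x / _)) divfK// gt_eqF.
Qed.

Lemma series_exp_coeff_le x n : 0 <= x -> series (exp_coeff x) n <= expR x.
Proof.
move=> x0; rewrite /expR; apply: nondecreasing_cvgn_le.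
  by apply: nondecreasing_series => k _ _; exact: exp_coeff_ge0.
exact: is_cvg_series_exp_coeff.
Qed.

Lemma norm_series_sin_coeff_le x n : `|series (sin_coeff x) n| <= expR `|x|.
Proof.
apply: le_trans (series_exp_coeff_le n (normr_ge0 x)).
rewrite /series/=; apply: le_trans (ler_norm_sum _ _ _) _.
apply: ler_sum => i _; rewrite /sin_coeff /exp_coeff/= !normrM normrX normfV.
rewrite !normr_nat; apply: ler_wpM2r; first by rewrite invr_ge0.
rewrite normrX ler_piMl ?exprn_ge0// normrN1 expr1n mulr1.
by case: (odd i).
Qed.

Lemma bernoulli_ineq (y : R) k : 0 <= y <= 1 -> 1 - k%:R * y <= (1 - y) ^+ k.
Proof.
move=> /andP[y0 y1]; elim: k => [|k ih]; first by rewrite mul0r subr0 expr0.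
rewrite exprS; apply: le_trans (ler_wpM2l _ ih); last by rewrite subr_ge0.
rewrite mulrBr mulr1 mulrBl mul1r -natr1 mulrDl mul1r opprB opprD.
by rewrite [leLHS]addrCA [in leRHS]addrA -addrA; have : 0 <= k%:R * (y * y) by [
  rewrite !mulr_ge0|]; lra.
Qed.

Lemma cvg_natM_expr (r : R) : 0 <= r < 1 -> n%:R * r ^+ n @[n --> \oo] --> (0 : R).
Proof.
move=> /andP[r0 r1].
have [->|rn0] := eqVneq r 0.
  rewrite (_ : (fun _ => _) = fun=> 0); first exact: cvg_cst.
  by apply/funext => -[|n]; rewrite ?mul0r// expr0n mulr0.
have {rn0} rp : 0 < r by rewrite lt_neqAle eq_sym rn0.
(* Half of the geometric decay, [s ^+ n], absorbs the factor [n]: Bernoulli's inequality for [s^-1]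
   bounds [n * s ^+ n] by [K]. The other half tends to 0. *)
pose s := Num.sqrt r.
have s0 : 0 < s by rewrite sqrtr_gt0.
have s1 : s < 1 by rewrite -[ltRHS]sqrtr1 ltr_sqrt.
have rE n : r ^+ n = s ^+ n * s ^+ n by rewrite -exprMn -expr2 sqr_sqrtr.
pose K := (s^-1 - 1)^-1.
have K0 : 0 < s^-1 - 1 by rewrite subr_gt0 invf_gt1.
have bnd n : n%:R * s ^+ n <= K.
  rewrite -ler_pdivlMr ?exprn_gt0// -exprVn /K mulrC ler_pdivlMr//.
  have: forall m, 1 + m%:R * (s^-1 - 1) <= s^-1 ^+ m.
    elim=> [|m ih]; first by rewrite mul0r addr0 expr0.
    rewrite exprS; apply: le_trans (ler_wpM2l _ ih); last by rewrite invr_ge0 ltW.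
    have : 0 <= m%:R * (s^-1 - 1) * (s^-1 - 1) by rewrite !mulr_ge0// ltW.
    by rewrite -natr1; nra.
  by move/(_ n); lra.
have up : K * s ^+ n @[n --> \oo] --> (0 : R).
  by apply: cvg_geometric; rewrite ger0_norm// ltW.
apply: (squeeze_cvgr _ (cvg_cst 0) up); apply: nearW => n.
rewrite rE mulrA mulr_ge0 ?mulr_ge0 ?exprn_ge0 ?(ltW s0)//=.
by rewrite ler_wpM2r ?exprn_ge0 ?(ltW s0).
Qed.

(* The exponent [n * 2 ^ n] is such that [t = 1/2] is sent to the same limit as
   [t > 1/2]. *)
Lemma cvg_step_half (t : R) : 0 <= t <= 1 ->
  (1 - t ^+ n) ^+ (n * 2 ^ n)%N @[n --> \oo] --> ((t < 2^-1)%R%:R : R).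
Proof.
move=> /andP[t0 t1].
have tn0 n : 0 <= t ^+ n by exact: exprn_ge0.
have tn1 n : t ^+ n <= 1 by exact: exprn_ile1.
have twoE n : (n * 2 ^ n)%:R * t ^+ n = n%:R * (t * 2) ^+ n :> R.
  by rewrite natrM natrX exprMn -mulrA [_ * t ^+ n]mulrC.
have [th|th] := ltP t 2^-1.
  rewrite mulr1n; have lo : 1 - n%:R * (t * 2) ^+ n @[n --> \oo] --> (1 : R).
    rewrite -[X in _ --> X]subr0; apply: cvgB; first exact: cvg_cst.
    by apply: cvg_natM_expr; rewrite mulr_ge0//= -ltr_pdivlMr// mul1r.
  apply: (squeeze_cvgr _ lo (cvg_cst (1 : R))); apply: nearW => n; apply/andP; split.
    by rewrite -twoE bernoulli_ineq// tn0 tn1.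
  by rewrite exprn_ile1// ?subr_ge0// gerBl.
rewrite mulr0n.
apply: (@squeeze_cvgr _ _ _ _ (fun=> 0) (fun n => expR (- n%:R))); last 2 first.
- exact: cvg_cst.
- exact: cvgn_expR.
apply: nearW => n.
apply/andP; split; first by rewrite exprn_ge0// subr_ge0.
apply: (@le_trans _ _ (expR (- t ^+ n) ^+ (n * 2 ^ n))).
  by apply: lerXn2r; rewrite ?nnegrE ?expR_ge0 ?subr_ge0// expR_ge1Dx.
rewrite -expRM_natl ler_expR mulrN lerN2 twoE ler_peMr//.
by rewrite exprn_ege1// -ler_pdivrMr// mul1r.
Qed.

(** For large [n] the argument lies in []-pi, pi[], where the sine has the sign of its argument.
    This removes the periodicity when sines are used to detect positivity. *)
Lemma cvg_sin_gt0 (x : R) :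
  ((0 < sin (x / n.+1%:R))%R%:R : R) @[n --> \oo] --> ((0 < x)%R%:R : R).
Proof.
have pi0 := pi_gt0 R.
have near_small y : 0 < y -> \forall n \near \oo, y / n.+1%:R < pi.
  move=> y0; have : y * n.+1%:R^-1 @[n --> \oo] --> 0.
    by rewrite -[X in _ --> X](mulr0 y); apply: cvgMl_tmp; exact: cvg_harmonic.
  by move=> /cvgr_lt; apply.
apply: cvg_near_cst; have [x0|x0|<-] := ltgtP 0 x.
- near=> n; rewrite sin_gt0_pi//; apply/andP; split.
    by rewrite divr_gt0.
  by near: n; exact: near_small.
- have := near_small (- x); rewrite oppr_gt0 => /(_ x0) ns.
  near=> n; apply/eqP; rewrite eqr_nat eqb0 -leNgt.
  rewrite -[x / _]opprK -mulNr sinN oppr_le0 ltW// sin_gt0_pi//.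
  apply/andP; split; first by rewrite divr_gt0// oppr_gt0.
  by near: n.
- by apply: nearW => n; rewrite mul0r sin0 ltxx.
Unshelve. all: by end_near. Qed.

End exp_bounds.

(** * Uniqueness of measures with equal exponential moments *)

Section exp_moment_uniqueness.
Context d (T : measurableType d) (R : realType).
Variables (mu nu : {measure set T -> \bar R}) (G : set (T -> R)).
Hypothesis mG : forall g, G g -> measurable_fun setT g.
Hypothesis G0 : G (fun=> 0).
Hypothesis GD : forall g h, G g -> G h -> G (fun x => g x + h x).
Hypothesis GZ : forall g (q : rat), G g -> G (fun x => ratr q * g x).
Hypothesis Gexp : forall g, G g -> eq_int mu nu (fun x => expR (g x)).
Local Notation eqi := (eq_int mu nu).

(* Since the functions [expR \o g] separate the measurable sets of interest but
   are unbounded, one works with the bounded functions against which they have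
   equal integrals. *)
Definition exp_test (F : T -> R) :=
  [/\ measurable_fun setT F, exists K, forall x, `|F x| <= K &
      forall g, G g -> eqi (fun x => F x * expR (g x))].

Let GZn g n : G g -> G (fun x => n%:R * g x).
Proof.
move=> /(GZ n%:R); congr G; by apply/funext => x; rewrite ratr_nat.
Qed.

Let GN g : G g -> G (fun x => - g x).
Proof.
move=> /(GZ (-1)); congr G; apply/funext => x.
by rewrite rmorphN rmorph1 mulN1r.
Qed.

Let GV g n : G g -> G (fun x => g x / n.+1%:R).
Proof.
move=> /(GZ (n.+1%:R^-1)); congr G; apply/funext => x.
by rewrite fmorphV/= ratr_nat mulrC.
Qed.

(** The natural majorant [exp (n |g|)] is not the exponential of an element of [G], but it is below
    [exp (n g) + exp (- n g)], whose integrability is known for both measures. *)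
Let dominating g' g n K : G g' -> G g ->
  eqi (fun x => K * (expR (g' x + n%:R * g x) + expR (g' x + - (n%:R * g x)))).
Proof.
by move=> Gg' Gg; apply/eq_intZ/eq_intD; apply/Gexp/GD => //; [|apply/GN]; exact: GZn.
Qed.

Let dominatingP (g' g : T -> R) n (a b K : R) x : 0 <= b -> `|a| <= K ->
  b <= expR (n%:R * `|g x|) ->
  `|a| * (expR (g' x) * b) <=
    K * (expR (g' x + n%:R * g x) + expR (g' x + - (n%:R * g x))).
Proof.
move=> b0 aK bn; rewrite !expRD -mulrDr.
apply: ler_pM => //; first by rewrite mulr_ge0// expR_ge0.
apply: ler_wpM2l; first exact: expR_ge0.
apply: (le_trans bn); rewrite -[X in X * _](@ger0_norm _ n%:R)// -normrM.
exact: expR_norm_le.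
Qed.

(** Each new factor [g] is the limit of [j (exp (g / j) - 1)]; multiplied by the lower power, this
    is a difference of two instances of the induction hypothesis, at [g' + g / j] and at [g']. Hence
    the generalization over [g']. *)
Lemma exp_test_moment F g g' n : exp_test F -> G g -> G g' ->
  eqi (fun x => F x * expR (g' x) * g x ^+ n).
Proof.
move=> [mF [K FK] hF] Gg; elim: n g' => [|n ih] g' Gg'.
  by have := hF _ Gg'; congr eqi; apply/funext => x; rewrite expr0 mulr1.
(* The difference quotient is at most [|g| exp |g|], and [|g| <= exp |g|]: the [n + 1] powers of
   [|g|] and the extra exponential give [exp ((n + 2) |g|)]. *)
pose D x := K * (expR (g' x + n.+2%:R * g x) + expR (g' x + - (n.+2%:R * g x))).
have [D1 D2 _] := dominating n.+2 K Gg' Gg.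
pose F_ j x := F x * expR (g' x) * g x ^+ n * (j.+1%:R * (expR (g x / j.+1%:R) - 1)).
apply: (@eq_int_lim _ _ _ _ _ F_ _ D) => //.
- move=> j.
  have := eq_intZ j.+1%:R (eq_intB (ih _ (GD Gg' (GV j Gg))) (ih _ Gg')).
  by congr eqi; apply/funext => x; rewrite /F_ expRD; ring.
- move=> x; rewrite exprSr mulrA; apply: cvgM; first exact: cvg_cst.
  exact: cvg_natZ_expR_divnB1.
- move=> j x; rewrite /F_ !normrM -!mulrA (@ger0_norm _ (expR _)) ?expR_ge0//.
  apply: dominatingP => //.
  have gx : `|g x / j.+1%:R| <= `|g x|.
    by rewrite normrM normfV normr_nat ler_piMr// invf_le1 ?ltr0n// ler1n.
  have h1 : `|j.+1%:R| * `|expR (g x / j.+1%:R) - 1| <= `|g x| * expR `|g x|.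
    rewrite normr_nat.
    apply: (@le_trans _ _ (j.+1%:R * (`|g x / j.+1%:R| * expR `|g x / j.+1%:R|))).
      by rewrite ler_wpM2l// norm_expRB1.
    rewrite mulrA normrM normfV normr_nat mulrCA mulfV ?pnatr_eq0// mulr1.
    rewrite ler_wpM2l// ler_expR; move: gx.
    by rewrite normrM normfV normr_nat.
  rewrite normrX expRM_natl.
  apply: (@le_trans _ _ (`|g x| ^+ n * (`|g x| * expR `|g x|))).
    by rewrite ler_wpM2l// exprn_ge0.
  rewrite mulrA -exprSr [leRHS]exprSr; apply: ler_wpM2r; first exact: expR_ge0.
  by apply: lerXn2r; rewrite ?nnegrE ?expR_ge0 ?normr_le_expR.
Qed.

Lemma exp_testD F1 F2 : exp_test F1 -> exp_test F2 -> exp_test (fun x => F1 x + F2 x).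
Proof.
move=> [mF1 [K1 FK1] hF1] [mF2 [K2 FK2] hF2]; split.
- exact: measurable_funD.
- by exists (K1 + K2) => x; apply: le_trans (ler_normD _ _) _; exact: lerD.
- move=> g Gg; have := eq_intD (hF1 _ Gg) (hF2 _ Gg).
  by congr eqi; apply/funext => x; rewrite mulrDl.
Qed.

Lemma exp_testZ (c : R) F : exp_test F -> exp_test (fun x => c * F x).
Proof.
move=> [mF [K FK] hF]; split.
- exact: measurable_funM.
- by exists (`|c| * K) => x; rewrite normrM ler_wpM2l.
- move=> g Gg; have := eq_intZ c (hF _ Gg).
  by congr eqi; apply/funext => x; rewrite mulrA.
Qed.

Lemma exp_test_lim (F_ : nat -> T -> R) (F : T -> R) (K : R) :
  (forall n, exp_test (F_ n)) -> (forall n x, `|F_ n x| <= K) ->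
  (forall x, F_ n x @[n --> \oo] --> F x) -> exp_test F.
Proof.
move=> hF FK cF; have FKl x : `|F x| <= K.
  have cn : `|F_ n x| @[n --> \oo] --> `|F x| by apply: cvg_norm; exact: cF.
  rewrite -(cvg_lim _ cn)//; apply: limr_le; first by apply: cvgP cn.
  exact: nearW.
split; last 2 first.
- by exists K.
- move=> g Gg; have [D1 D2 _] := eq_intZ K (Gexp Gg).
  apply: (@eq_int_lim _ _ _ _ _ (fun n x => F_ n x * expR (g x)) _
    (fun x => K * expR (g x))) => //.
  + by move=> n; have [_ _] := hF n; exact.
  + by move=> x; apply: cvgM; [exact: cF|exact: cvg_cst].
  + move=> n x; rewrite normrM (@ger0_norm _ (expR _)) ?expR_ge0//.
    by rewrite ler_wpM2r ?expR_ge0.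
- by apply: (measurable_fun_cvg (h := F_)) => [n|x _]; [have [] := hF n|exact: cF].
Qed.

(** The sine is bounded, so the product is again a bounded test function, while its Taylor sums are
    polynomials in [g] dominated by [exp |g|]; the moments and dominated convergence conclude. *)
Lemma exp_test_sin F g : exp_test F -> G g -> exp_test (fun x => F x * sin (g x)).
Proof.
move=> hF Gg; have [mF [K FK] _] := hF.
split.
- apply: measurable_funM => //; apply: measurableT_comp; last exact: mG.
  by apply: continuous_measurable_fun; exact: continuous_sin.
- exists K => x; rewrite normrM -[leRHS]mulr1 ler_pM//.
  by rewrite ler_norml sin_geN1 sin_le1.
- move=> g' Gg'; have [D1 D2 _] := dominating 1 K Gg' Gg.
  pose F_ n x := F x * expR (g' x) * series (sin_coeff (g x)) n.
  apply: (@eq_int_lim _ _ _ _ _ F_ _ _ _ _ _ D1 D2).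
  + move=> n.
    have := @eq_int_sum _ _ _ mu nu nat (index_iota 0 n) _
      (fun k => eq_intZ ((odd k)%:R * (-1) ^+ k.-1./2 * k`!%:R^-1)
         (exp_test_moment k hF Gg Gg')).
    congr eqi; apply/funext => x; rewrite /F_ /series/= mulr_sumr.
    by apply: eq_bigr => k _; rewrite /sin_coeff/=; ring.
  + move=> x; rewrite (mulrAC (F x)); apply: cvgM; first exact: cvg_cst.
    rewrite unlock; exact: is_cvg_series_sin_coeff.
  + move=> n x; rewrite /F_ !normrM -!mulrA (@ger0_norm _ (expR _)) ?expR_ge0//.
    by apply: dominatingP => //; rewrite mul1r norm_series_sin_coeff_le.
Qed.

(** With [t = (1 - sin g) / 2], which lies in [0, 1], the condition becomes [t < 1/2]. Test
    functions can be multiplied by polynomials in [t], and the polynomials of [cvg_step_half]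
    converge everywhere to this indicator, also at [t = 1/2]. *)
Lemma exp_test_sin_gt0 F g : exp_test F -> G g ->
  exp_test (fun x => F x * (0 < sin (g x))%R%:R).
Proof.
move=> hF Gg; have [mF [K FK] _] := hF.
pose t x := (1 - sin (g x)) / 2.
have t01 x : 0 <= t x <= 1.
  by have := sin_geN1 (g x); have := sin_le1 (g x); rewrite /t; lra.
have htn H n : exp_test H -> exp_test (fun x => H x * t x ^+ n).
  move=> hH; elim: n => [|n ih].
    by rewrite (_ : (fun _ => _) = H)//; apply/funext => x; rewrite expr0 mulr1.
  have := exp_testD (exp_testZ 2^-1 ih) (exp_testZ (- 2^-1) (exp_test_sin ih Gg)).
  congr exp_test; apply/funext => x.
  have -> : t x ^+ n.+1 = (2^-1 - 2^-1 * sin (g x)) * t x ^+ n.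
    by rewrite exprS; congr (_ * _); rewrite /t; field.
  by ring.
have h1tn H n k : exp_test H -> exp_test (fun x => H x * (1 - t x ^+ n) ^+ k).
  move=> hH; elim: k => [|k ih].
    by rewrite (_ : (fun _ => _) = H)//; apply/funext => x; rewrite expr0 mulr1.
  have := exp_testD ih (exp_testZ (-1) (htn _ n ih)).
  by congr exp_test; apply/funext => x; rewrite exprS; ring.
apply: (@exp_test_lim (fun n x => F x * (1 - t x ^+ n) ^+ (n * 2 ^ n)%N) _ K).
- by move=> n; exact: h1tn.
- move=> n x; rewrite normrM; apply: le_trans (FK x); rewrite ler_piMr//.
  have /andP[t0 t1] := t01 x; have tn0 : 0 <= t x ^+ n by exact: exprn_ge0.
  have tn1 : t x ^+ n <= 1 by exact: exprn_ile1.
  rewrite ger0_norm ?exprn_ge0 ?subr_ge0//.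
  by rewrite exprn_ile1 ?subr_ge0 ?gerBl.
- move=> x; apply: cvgM; first exact: cvg_cst.
  rewrite (_ : (0 < sin (g x)) = (t x < 2^-1)); first exact: cvg_step_half.
  by rewrite /t; apply/idP/idP; lra.
Qed.

Lemma exp_test_gt0 F g : exp_test F -> G g ->
  exp_test (fun x => F x * (0 < g x)%R%:R).
Proof.
move=> hF Gg; have [mF [K FK] _] := hF.
apply: (@exp_test_lim (fun n x => F x * (0 < sin (g x / n.+1%:R))%R%:R) _ K).
- by move=> n; apply: exp_test_sin_gt0 => //; exact: GV.
- move=> n x; rewrite normrM normr_nat; apply: le_trans (FK x).
  by rewrite ler_piMr//; case: (0 < _).
- by move=> x; apply: cvgM; [exact: cvg_cst|exact: cvg_sin_gt0].
Qed.

(** The sets whose indicator may multiply every test function form a pi-system, since indicators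
    multiply, and it contains the generating half-spaces. The test function 1 with [g = 0] gives
    equality of the measures on it, and [exp 0] being integrable makes them finite. Only rational
    multiples are required in [G], so that countably many exponents are enough for the posterior. *)
Lemma exp_moment_unique (B : set T) :
  <<s [set [set x | 0 < g x] | g in G]>> B -> mu B = nu B.
Proof.
have C1 : exp_test (fun=> 1).
  split; first exact: measurable_cst.
    by exists 1 => x; rewrite normr1.
  by move=> g /Gexp; congr eqi; apply/funext => x; rewrite mul1r.
pose S := [set B1 : set T | measurable B1 /\
  forall F, exp_test F -> exp_test (fun x => F x * \1_B1 x)].
have ST : S setT.
  split=> // F; congr exp_test; apply/funext => x.
  by rewrite indicE in_setT mulr1.
have SI : setI_closed S.
  move=> B1 B2 [mB1 h1] [mB2 h2]; split; first exact: measurableI.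
  move=> F /h1/h2; congr exp_test; apply/funext => x.
  by rewrite indicI/= mulrA.
have SE B1 : S B1 -> mu B1 = nu B1.
  move=> [mB1 /(_ _ C1)[_ _ /(_ _ G0)[_ _]]].
  under eq_integral do rewrite expR0 mulr1 mul1r.
  under [in RHS]eq_integral do rewrite expR0 mulr1 mul1r.
  by rewrite !integral_indic// !setIT.
have muT : (mu setT < +oo)%E.
  have [/integrableP[_ +] _ _] := Gexp G0.
  under eq_integral do rewrite /= expR0 normr1.
  by rewrite integral_cst// mul1e.
move=> hB; apply: (@g_sigma_algebra_measure_unique _ _ _ S _ (fun=> setT)) => //.
- by move=> B1 [].
- by rewrite bigcup_const//; exists 0%N.
- apply: sub_sigma_algebra2 hB => _ [g Gg <-]; split.
    have := mG Gg measurableT (measurable_itv `]0, +oo[).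
    by rewrite setTI; congr measurable; apply/seteqP; split => x /=; rewrite in_itv/= andbT.
  move=> F hF; have := exp_test_gt0 hF Gg; congr exp_test.
  by apply/funext => x; rewrite indicE; congr (_ * (nat_of_bool _)%:R);
    apply/idP/idP; rewrite inE.
Qed.

End exp_moment_uniqueness.

(** * Hilbert spaces *)

Section inner_theory.
Context {R : realType} {V : hilbertType R}.
Implicit Types (f g h : V) (a : R).

Lemma innerDr f g h : inner h (f + g) = inner h f + inner h g.
Proof. by rewrite innerC innerDl !(innerC h). Qed.

Lemma innerZr a f g : inner f (a *: g) = a * inner f g.
Proof. by rewrite innerC innerZl innerC. Qed.

Lemma inner0l f : inner 0 f = 0.
Proof. by rewrite -(scale0r (0 : V)) innerZl mul0r. Qed.

Lemma inner0r f : inner f 0 = 0.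
Proof. by rewrite innerC inner0l. Qed.

Lemma innerNl f g : inner (- f) g = - inner f g.
Proof. by rewrite -scaleN1r innerZl mulN1r. Qed.

Lemma innerNr f g : inner f (- g) = - inner f g.
Proof. by rewrite innerC innerNl innerC. Qed.

Lemma innerBl f g h : inner (f - g) h = inner f h - inner g h.
Proof. by rewrite innerDl innerNl. Qed.

Lemma innerBr f g h : inner h (f - g) = inner h f - inner h g.
Proof. by rewrite innerDr innerNr. Qed.

Lemma inner_suml (I : Type) (s : seq I) (F : I -> V) h :
  inner (\sum_(i <- s) F i) h = \sum_(i <- s) inner (F i) h.
Proof.
elim: s => [|i s ih]; first by rewrite !big_nil inner0l.
by rewrite !big_cons innerDl ih.
Qed.

Lemma sqnormD f g : `|f + g| ^+ 2 = `|f| ^+ 2 + 2 * inner f g + `|g| ^+ 2.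
Proof. by rewrite -!inner_sqnorm innerDl !innerDr (innerC g f); ring. Qed.

Lemma norm_inner_le f g : `|inner f g| <= `|f| * `|g|.
Proof.
have [->|g0] := eqVneq g 0; first by rewrite inner0r normr0 mulr_ge0.
have gg : 0 < `|g| by rewrite normr_gt0.
(* The component of [f] orthogonal to [g], scaled by [|g|^2] to avoid division. *)
have := sqr_ge0 `| (`|g| ^+ 2 *: f - inner f g *: g) |.
rewrite sqnormD normrN !normrZ innerNr innerZl innerZr !exprMn.
rewrite (@real_normK _ (inner f g)) ?num_real// normr_id.
set i := inner f g => H.
have {H} : i ^+ 2 <= (`|f| * `|g|) ^+ 2.
  rewrite -(ler_pM2l (exprn_gt0 2 gg)) exprMn; apply: le_trans (_ : _ <= _); last exact: lexx.
  move: H; nra.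
by rewrite -[i ^+ 2]real_normK ?num_real// ler_sqr ?nnegrE ?mulr_ge0.
Qed.

Lemma inner_ext_eq f g : (forall h, inner f h = inner g h) -> f = g.
Proof.
move=> fg; apply/eqP; rewrite -subr_eq0 -normr_eq0 -sqrf_eq0 -inner_sqnorm.
by rewrite innerBl fg subrr.
Qed.

Lemma continuous_innerl h : continuous (inner ^~ h : V -> R).
Proof.
move=> x; apply/cvgrPdist_le => /= e e0; near=> y.
rewrite -innerBl; apply: le_trans (norm_inner_le _ _) _.
apply: (@le_trans _ _ (`|x - y| * (`|h| + 1))).
  by rewrite ler_wpM2l// lerDl.
rewrite -ler_pdivlMr ?ltr_wpDl//.
near: y; apply: cvgr_dist_le; first exact: cvg_id.
by rewrite divr_gt0 ?ltr_wpDl.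
Unshelve. all: by end_near. Qed.

End inner_theory.

(** * Symmetric coercive variational problems *)

Section minimization.
Context {R : realType} {V : hilbertType R}.
Variables (B : V -> V -> R) (F : V -> R) (alpha C K : R).
Hypothesis BDl : forall f g h, B (f + g) h = B f h + B g h.
Hypothesis BZl : forall a f h, B (a *: f) h = a * B f h.
Hypothesis BC : forall f g, B f g = B g f.
Hypothesis alpha_gt0 : 0 < alpha.
Hypothesis B_coercive : forall f, alpha * `|f| ^+ 2 <= B f f.
Hypothesis B_bounded : forall f g, `|B f g| <= C * `|f| * `|g|.
Hypothesis FD : forall f g, F (f + g) = F f + F g.
Hypothesis FZ : forall a f, F (a *: f) = a * F f.
Hypothesis F_bounded : forall f, `|F f| <= K * `|f|.

Let J f := B f f - 2 * F f.

Let JD f g a : J (f + a *: g) = J f + 2 * a * (B f g - F g) + a ^+ 2 * B g g.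
Proof.
rewrite /J !FD !FZ BDl ![B _ (_ + _)]BC !BDl !BZl [B _ (a *: g)]BC BZl.
by rewrite [B g (a *: g)]BC BZl (BC g f); ring.
Qed.

(* The solution minimizes [J]; minimizing sequences are Cauchy by the
   parallelogram identity. *)
Lemma bilinear_solve : exists u, forall h, B u h = F h.
Proof.
have J_lb f : - (K ^+ 2 / alpha) <= J f.
  have h1 := B_coercive f; have := F_bounded f; rewrite ler_norml => /andP[_ h2].
  apply: (@le_trans _ _ (alpha * `|f| ^+ 2 - 2 * (K * `|f|))); last by rewrite /J; lra.
  rewrite -subr_ge0.
  have -> : alpha * `|f| ^+ 2 - 2 * (K * `|f|) - - (K ^+ 2 / alpha) =
            (alpha * `|f| - K) ^+ 2 / alpha.
    by field; rewrite gt_eqF.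
  by rewrite mulr_ge0 ?sqr_ge0// invr_ge0 ltW.
have hJ : has_inf (range J).
  by split; [exists (J 0), 0|exists (- (K ^+ 2 / alpha)) => _ [f _ <-]].
pose m := inf (range J).
have mJ f : m <= J f by apply: ge_inf; [case: hJ|exists f].
have /choice[u uP] n : exists u, J u <= m + n.+1%:R^-1.
  have n0 : 0 < n.+1%:R^-1 :> R by rewrite invr_gt0.
  have [_ [u _ <-] /ltW] := inf_adherent n0 hJ.
  by exists u.
have ucau n k : alpha * `|u n - u k| ^+ 2 <= 2 * (n.+1%:R^-1 + k.+1%:R^-1).
  apply: le_trans (B_coercive _) _.
  have := mJ (u n + 2^-1 *: (u k - u n)); rewrite JD.
  have := uP n; have := uP k; rewrite -[in J (u k)](subrK (u n) (u k)) addrC.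
  rewrite -[X in J (_ + X)]scale1r JD.
  have -> : B (u n - u k) (u n - u k) = B (u k - u n) (u k - u n).
    by rewrite -opprB -scaleN1r BZl BC BZl; ring.
  have -> : (2^-1 : R) ^+ 2 = 4^-1 by field.
  rewrite expr1n; set Y := B (u n) _ - _; set Z := B (u k - u n) _.
  set a := n.+1%:R^-1; set b := k.+1%:R^-1; lra.
have alpha0 := alpha_gt0.
have /cvg_ex[v uv] : cvgn u.
  apply: cauchy_cvg; apply: cauchy_exP => e e0.
  have : 2 * (n.+1%:R^-1 + n.+1%:R^-1) @[n --> \oo] --> (2 * (0 + 0) : R).
    by apply: cvgM; [exact: cvg_cst|apply: cvgD; exact: cvg_harmonic].
  rewrite addr0 mulr0 => /cvgr_lt /(_ (alpha * e ^+ 2)).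
  rewrite mulr_gt0 ?exprn_gt0// => /(_ isT)[n _ hn].
  exists (u n); exists n => // k /= nk; rewrite -ball_normE/=.
  have := ucau n k; have := hn n (leqnn n) => /= h1 h2.
  have {}h2 : alpha * `|u n - u k| ^+ 2 < alpha * e ^+ 2.
    apply: le_lt_trans h2 _; apply: le_lt_trans h1.
    rewrite ler_wpM2l// lerD2l lef_pV2 ?posrE ?ltr0n// ler_nat ltnS//.
  by move: h2; rewrite ltr_pM2l// ltr_sqr ?nnegrE// ltW.
exists v => h.
have key t : 0 <= 2 * t * (B v h - F h) + t ^+ 2 * B h h.
  have cB : B (u n) h @[n --> \oo] --> B v h.
    have cn : C * `|u n - v| * `|h| @[n --> \oo] --> C * `|v - v| * `|h|.
      apply: cvgM; last exact: cvg_cst.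
      apply: cvgM; first exact: cvg_cst.
      by apply: cvg_norm; apply: cvgB => //; exact: cvg_cst.
    rewrite subrr normr0 mulr0 mul0r in cn.
    apply/cvgrPdist_le => /= e e0; move/cvgr_le: cn => /(_ e e0).
    apply: filterS => n; apply: le_trans.
    by rewrite distrC -[- B v h]mulN1r -BZl scaleN1r -BDl B_bounded.
  have c1 : 2 * t * (B (u n) h - F h) + t ^+ 2 * B h h + n.+1%:R^-1 @[n --> \oo] -->
            2 * t * (B v h - F h) + t ^+ 2 * B h h + 0.
    apply: cvgD; last exact: cvg_harmonic.
    apply: cvgD; last exact: cvg_cst.
    apply: cvgM; first exact: cvg_cst.
    by apply: cvgB => //; exact: cvg_cst.
  rewrite addr0 in c1; rewrite -(cvg_lim _ c1)//.
  apply: limr_ge; first exact: cvgP c1.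
  apply: nearW => n; have := mJ (u n + t *: h); rewrite JD.
  have := uP n; set a := n.+1%:R^-1; set X := J (u n).
  by set Y := 2 * t * _; set Z := t ^+ 2 * _; lra.
set z := B v h - F h in key.
suff : z = 0 by rewrite /z => /subr0_eq.
have Bh : 0 <= B h h by apply: le_trans (B_coercive h); rewrite mulr_ge0// ?ltW ?exprn_ge0.
(* Nearly the minimizer of the quadratic in [t]; the [+ 1] keeps the denominator positive when
   [B h h = 0]. The value there is negative unless [z = 0]. *)
have := key (- z / (B h h + 1)).
have -> : 2 * (- z / (B h h + 1)) * z + (- z / (B h h + 1)) ^+ 2 * B h h =
   - (z ^+ 2 * (B h h + 2) / (B h h + 1) ^+ 2).
  by field; rewrite gt_eqF// ltr_wpDl.
rewrite oppr_ge0 pmulr_lle0 ?invr_gt0 ?exprn_gt0 ?ltr_wpDl//.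
rewrite pmulr_lle0 ?ltr_wpDl// => z0.
by apply/eqP; rewrite -sqrf_eq0 eq_le z0 sqr_ge0.
Qed.

End minimization.

(** * Gram-Schmidt orthogonalization of a sequence *)

Section gram_schmidt.
Context {R : realType} {V : hilbertType R}.
Implicit Types (s : seq V) (d : nat -> V) (x : V).

Definition proj s x : V := \sum_(e <- s) inner x e *: e.

(** The sequence may be linearly dependent: if the remainder [r] is 0, then so is the appended
    vector, which contributes nothing to projections. The list is thus orthogonal, with entries of
    norm 1 or 0. *)
Fixpoint gram_schmidt d n : seq V :=
  if n is m.+1 then
    let r := d m - proj (gram_schmidt d m) (d m) in
    rcons (gram_schmidt d m) (`|r|^-1 *: r)
  else [::].

Lemma projD s x y : proj s (x + y) = proj s x + proj s y.
Proof. by rewrite /proj -big_split/=; apply: eq_bigr => e _; rewrite innerDl scalerDl. Qed.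

Lemma proj_rcons s e x : proj (rcons s e) x = proj s x + inner x e *: e.
Proof. by rewrite /proj -cats1 big_cat big_seq1. Qed.

Let gs_proj d n x e : e \in gram_schmidt d n ->
  inner (x - proj (gram_schmidt d n) x) e = 0.
Proof.
elim: n x e => [//|n ih] x e; rewrite [gram_schmidt d n.+1]/=.
set s := gram_schmidt d n; set r := d n - proj s (d n); set u := _ *: r.
have ru e' : e' \in s -> inner u e' = 0.
  by move=> e's; rewrite innerZl ih// mulr0.
have pu y : inner (proj s y) u = 0.
  rewrite /proj inner_suml big_seq big1// => e' e's.
  by rewrite innerZl (innerC e') ru// mulr0.
rewrite proj_rcons opprD addrA mem_rcons in_cons => /predU1P[->|es].
  rewrite innerBl innerBl pu subr0 innerZl.
  have [r0|r0] := eqVneq r 0; first by rewrite /u r0 scaler0 !inner0r mulr0 subrr.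
  suff -> : inner u u = 1 by rewrite mulr1 subrr.
  by rewrite /u innerZl innerZr inner_sqnorm; field; rewrite normr_eq0.
by rewrite innerBl ih// innerZl ru// mulr0 subrr.
Qed.

Lemma gram_schmidt_pythagoras d n x :
  `|x - proj (gram_schmidt d n) x| ^+ 2 =
  `|x| ^+ 2 - \sum_(e <- gram_schmidt d n) inner x e ^+ 2.
Proof.
set s := gram_schmidt d n.
have px : inner (x - proj s x) (proj s x) = 0.
  rewrite innerC inner_suml big_seq big1// => e es.
  by rewrite innerZl (innerC e) gs_proj// mulr0.
rewrite -!inner_sqnorm innerBr px subr0 innerBl; congr (_ - _).
by rewrite inner_suml; apply: eq_bigr => e _; rewrite innerZl innerC expr2.
Qed.

Lemma gram_schmidt_bessel d n x :
  \sum_(e <- gram_schmidt d n) inner x e ^+ 2 <= `|x| ^+ 2.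
Proof. by rewrite -subr_ge0 -gram_schmidt_pythagoras exprn_ge0. Qed.

Let gs_resid_le d n k x : (n <= k)%N ->
  `|x - proj (gram_schmidt d k) x| ^+ 2 <= `|x - proj (gram_schmidt d n) x| ^+ 2.
Proof.
move=> /subnK <-; elim: (k - n)%N => [|m ih]; first by rewrite add0n.
apply: le_trans ih; rewrite !gram_schmidt_pythagoras addSn/= -cats1 big_cat big_seq1/=.
by rewrite lerD2l lerN2 lerDl sqr_ge0.
Qed.

Let gs_exact d n k : (n < k)%N -> proj (gram_schmidt d k) (d n) = d n.
Proof.
move=> nk; apply/esym/eqP; rewrite -subr_eq0 -normr_eq0 -sqrf_eq0 eq_le.
rewrite exprn_ge0// andbT; apply: le_trans (gs_resid_le _ _ nk) _ => /=.
set s := gram_schmidt d n; set r := d n - proj s (d n).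
suff -> : d n - proj (rcons s (`|r|^-1 *: r)) (d n) = 0 by rewrite normr0 expr0n.
rewrite proj_rcons opprD addrA -/r.
have [->|r0] := eqVneq r 0; first by rewrite !scaler0 subr0.
have -> : inner (d n) (`|r|^-1 *: r) = `|r|.
  rewrite -[d n](subrK (proj s (d n))) -/r innerDl [X in _ + X]innerC innerZl.
  rewrite innerZr inner_sqnorm (innerC r).
  rewrite [X in inner X r]/proj inner_suml big_seq big1 => [|e es].
    by field; rewrite normr_eq0.
  by rewrite innerZl (innerC e) gs_proj// mulr0.
by rewrite scalerA mulfV ?normr_eq0// scale1r subrr.
Qed.

(** By Pythagoras the gap is the squared residual of [x]. Since [d n] is reproduced exactly at all
    later stages, this is also the residual of [x - d n], hence at most [|x - d n|^2]. *)
Lemma cvg_gram_schmidt d x : dense (range d) ->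
  \sum_(e <- gram_schmidt d n) inner x e ^+ 2 @[n --> \oo] --> `|x| ^+ 2.
Proof.
move=> dd; apply/cvgrPdist_lt => /= eps eps0.
pose eta := Num.min 1 eps.
have eta0 : 0 < eta by rewrite lt_min ltr01.
have [] := dd (ball x eta).
- by exists x; exact: ballxx.
- exact: ball_open.
move=> _ [/[swap] [[n _ <-]]]; rewrite -ball_normE /= => xn.
exists n.+1 => // k /= nk.
rewrite ger0_norm; last by rewrite -gram_schmidt_pythagoras exprn_ge0.
rewrite -gram_schmidt_pythagoras.
have -> : x - proj (gram_schmidt d k) x =
    (x - d n) - proj (gram_schmidt d k) (x - d n).
  have := projD (gram_schmidt d k) (x - d n) (d n); rewrite subrK => ->.
  by rewrite (gs_exact _ nk) opprD addrA addrAC.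
apply: (@le_lt_trans _ _ (`|x - d n| ^+ 2)).
  rewrite gram_schmidt_pythagoras lerBlDr lerDl.
  by apply: sumr_ge0 => e _; exact: sqr_ge0.
move: xn; rewrite /eta lt_min => /andP[h1 h2].
by rewrite expr2; apply: le_lt_trans h2; rewrite ler_piMr// ltW.
Qed.

End gram_schmidt.

(** * Borel sets of a separable Hilbert space *)

Section borel_theory.
Context {R : realType} {V : hilbertType R}.

Lemma continuous_borel_measurable (f : V -> R) : continuous f ->
  measurable_fun [set: borel V] (f : borel V -> measurableTypeR R).
Proof.
move=> cf; apply: (measurability _ (RGenOInfty.measurableE R)) => _ [_ [a ->] <-].
rewrite setTI; apply: sub_sigma_algebra; apply: open_comp => //.
Qed.

Lemma continuous_borel_measurable_endo (f : V -> V) : continuous f ->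
  measurable_fun [set: borel V] (f : borel V -> borel V).
Proof.
move=> cf; apply: (@measurability _ _ (borel V) (borel V) setT f (@open V) erefl) => _ [B oB <-].
rewrite setTI; apply: sub_sigma_algebra; apply: open_comp => // x _; exact: cf.
Qed.

Lemma measurable_inner (h : V) :
  measurable_fun [set: borel V] (fun f : borel V => inner (f : V) h : measurableTypeR R).
Proof. by apply: continuous_borel_measurable; exact: continuous_innerl. Qed.

Lemma measurable_hnorm :
  measurable_fun [set: borel V] (fun f : borel V => `|(f : V)| : measurableTypeR R).
Proof. by apply: continuous_borel_measurable; exact: norm_continuous. Qed.

(** The constant term provides half-spaces at every level from the single condition [0 < g x]. *)
Definition affine_functionals : set (borel V -> R) :=
  [set g | exists h r, g = fun x => inner (x : V) h + r].

Lemma separable_dense_seq : separable V -> exists d : nat -> V, dense (range d).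
Proof.
move=> [D [cD dD]].
have [x Dx] : D !=set0.
  by have [] := dD setT; [exists 0|exact: openT|move=> x [_ Dx]; exists x].
have /pfcard_geP[D0|[f]] : (D #<= [set: nat])%card by [].
  by rewrite D0 in Dx.
exists f => U U0 oU; have [y [Uy Dy]] := dD U U0 oU.
by exists y; split=> //; have [n _ <-] := 'surj_f Dy; exists n.
Qed.

(* Squared norms are countable limits of sums of squares of inner products, so
   half-spaces generate the balls, hence the Borel sets. *)
Lemma borel_halfspaces (B : set (borel V)) : separable V -> measurable B ->
  <<s [set [set x | 0 < g x] | g in affine_functionals]>> B.
Proof.
move=> /separable_dense_seq[d dd].
set H := [set [set x | 0 < g x] | g in _].
pose T := g_sigma_algebraType H.
have mi (h : V) : measurable_fun [set: T] (fun x : T => inner (x : V) h : measurableTypeR R).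
  apply: (measurability _ (RGenOInfty.measurableE R)) => _ [_ [a ->] <-].
  rewrite setTI; apply: sub_sigma_algebra; exists (fun x => inner (x : V) h + - a).
    by exists h, (- a).
  by apply/seteqP; split => x /=; rewrite in_itv/= andbT subr_gt0.
have mn (a : V) : measurable_fun [set: T] (fun x : T => `|(x : V) - a| ^+ 2 : measurableTypeR R).
  apply: (@measurable_fun_cvg _ _ _ _ (fun n (x : T) =>
    \sum_(e <- gram_schmidt d n) inner ((x : V) - a) e ^+ 2)).
    move=> n; apply: measurable_sum => e.
    apply: measurable_funX.
    rewrite (_ : (fun _ => _) = fun x : T => inner (x : V) e - inner a e).
      exact: (measurable_funB (mi e) (measurable_cst _)).
    by apply/funext => x; rewrite innerBl.
  by move=> x _; exact: cvg_gram_schmidt.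
have mb (a : V) (r : R) : 0 <= r -> measurable ([set x | `|x - a| < r] : set T).
  move=> r0; have := mn a measurableT _ (measurable_itv `]-oo, r ^+ 2[).
  rewrite setTI; congr measurable; apply/seteqP; split => x /=;
    by rewrite in_itv/= ltr_sqr ?nnegrE.
suff : @open V `<=` (@measurable _ T).
  by move=> oT; exact: (smallest_sub (@smallest_sigma_algebra _ setT H) oT).
move=> U oU.
rewrite (_ : U = \bigcup_k \bigcup_n (if `[< [set x | `|x - d k| < n.+1%:R^-1] `<=` U >]
    then [set x | `|x - d k| < n.+1%:R^-1] else set0)).
  apply: bigcup_measurable => k _; apply: bigcup_measurable => n _.
  by case: ifPn => // _; apply: mb.
apply/seteqP; split => [x Ux|x [k _ [n _]]]; last first.
  by case: ifPn => //= /asboolP; apply.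
move: oU; rewrite openE => /(_ _ Ux); rewrite /interior -nbhs_ballE => -[e /= e0 xeU].
have [n n0] : exists n, n.+1%:R^-1 + n.+1%:R^-1 < e.
  have : n.+1%:R^-1 + n.+1%:R^-1 @[n --> \oo] --> (0 + 0 : R).
    by apply: cvgD; exact: cvg_harmonic.
  rewrite addr0 => /cvgr_lt /(_ e e0)[n _ /(_ n (leqnn n))] /= h; by exists n.
have n1 : 0 < n.+1%:R^-1 :> R by rewrite invr_gt0.
have [_ [/[swap] [[k _ <-]]]] := dd (ball x n.+1%:R^-1)
  (ex_intro _ x (ballxx x n1)) (ball_open _ _).
rewrite -ball_normE/= => xk.
exists k => //; exists n => //; case: ifPn => //= /asboolPn nU; exfalso; apply: nU.
move=> y /= yk; apply: xeU; rewrite -ball_normE/=.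
apply: le_lt_trans n0; rewrite -(subrKA (d k)); apply: le_trans (ler_normD _ _) _.
by apply: lerD; rewrite ltW// distrC.
Qed.

End borel_theory.

Section law_integral.
Local Open Scope ereal_scope.
Context d d' (T : measurableType d) (T' : measurableType d') (R : realType).
Variables (mu : {measure set T -> \bar R}) (nu : {measure set T' -> \bar R}) (X : T -> T').
Hypothesis mX : measurable_fun setT X.
Hypothesis XE : forall B, measurable B -> mu (X @^-1` B) = nu B.

Lemma ge0_integral_law (F : T' -> \bar R) : measurable_fun setT F ->
  (forall x, 0 <= F x) -> \int[mu]_x F (X x) = \int[nu]_y F y.
Proof.
move=> mF F0; pose m := mfun_Sub (mem_set mX) : {mfun T >-> T'}.
have -> : \int[nu]_y F y = \int[pushforward mu m]_y F y.
  by apply: eq_measure_integral => A mA _; exact: (esym (XE mA)).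
rewrite ge0_integral_pushforward// => y _; exact: F0.
Qed.

Lemma integrable_law (F : T' -> \bar R) : measurable_fun setT F ->
  mu.-integrable setT (F \o X) <-> nu.-integrable setT F.
Proof.
move=> mF; split => /integrableP[_ h]; apply/integrableP; split => //.
- rewrite -ge0_integral_law//; exact: measurableT_comp.
- exact: measurableT_comp.
- by rewrite (@ge0_integral_law (fun y => `|F y|))//; exact: measurableT_comp.
Qed.

Lemma integral_law (F : T' -> \bar R) : measurable_fun setT F ->
  \int[mu]_x F (X x) = \int[nu]_y F y.
Proof.
move=> mF; rewrite integralE [RHS]integralE; congr (_ - _).
- have -> : (fun x => F (X x))^\+ = F^\+ \o X by apply/funext => x; rewrite /= !funeposE.
  by apply: (@ge0_integral_law F^\+) => //; exact: measurable_funepos.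
- have -> : (fun x => F (X x))^\- = F^\- \o X by apply/funext => x; rewrite /= !funenegE.
  by apply: (@ge0_integral_law F^\-) => //; exact: measurable_funeneg.
Qed.

End law_integral.

(** * Gaussian variables and Gaussian measures *)

Section centered_normal_moments.
Context {R : realType}.
Implicit Types s t x : R.
Local Notation N s := (centered_normal s : probability (measurableTypeR R) R).

Lemma centered_normal_mgf s t :
  (\int[N s]_x (expR (t * x))%:E = (expR (t ^+ 2 * s ^+ 2 / 2))%:E)%E.
Proof.
have me : measurable_fun [set: R] (fun x : R => (expR (t * x))%:E).
  by apply/measurable_EFinP; apply: measurableT_comp.
rewrite /centered_normal; have [->|s0] := eqVneq s 0.
  by rewrite integral_dirac// diracT mul1e mulr0 expr0n/= mulr0 mul0r.
rewrite (@ge0_integral_density _ _ _ lebesgue_measure _ (normal_pdf 0 s))//; last 2 first.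
- exact: measurable_normal_pdf.
- exact: normal_pdf_ge0.
(* Completing the square turns the tilted density into a multiple of the normal density with mean
   [t s^2], whose integral is 1. *)
transitivity (\int[lebesgue_measure]_x ((expR (t ^+ 2 * s ^+ 2 / 2))%:E *
    (normal_pdf (t * s ^+ 2) s x)%:E))%E.
  apply: eq_integral => x _; rewrite -!EFinM !normal_pdfE//; congr EFin.
  rewrite ![_ * (normal_peak _ * _)]mulrCA -!expRD; congr (_ * expR _).
  by field; rewrite s0.
rewrite ge0_integralZl//; last 2 first.
- by apply/measurable_EFinP; exact: measurable_normal_pdf.
- by move=> x _; rewrite lee_fin normal_pdf_ge0.
by rewrite integral_normal_pdf mule1.
Qed.

Lemma expRM_integrable s t : (N s).-integrable setT (fun x : R => (expR (t * x))%:E).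
Proof.
apply/integrableP; split.
  by apply/measurable_EFinP; apply: measurableT_comp.
under eq_integral do rewrite gee0_abs ?lee_fin ?expR_ge0//.
by rewrite centered_normal_mgf ltry.
Qed.

Lemma expR_norm_integrable s t : (N s).-integrable setT (fun x : R => (expR (t * `|x|))%:E).
Proof.
have := integrableD measurableT (expRM_integrable s t) (expRM_integrable s (- t)).
apply: le_integrable => //.
  by apply/measurable_EFinP; apply: measurableT_comp => //; apply: measurable_funM.
move=> x _ /=; rewrite lee_fin (ger0_norm (expR_ge0 _)).
rewrite (ger0_norm (addr_ge0 (expR_ge0 _) (expR_ge0 _))).
by case: (ger0P x) => _; rewrite ?mulrN mulNr ?opprK ?lerDl ?lerDr expR_ge0.
Qed.

Lemma cvg_sqr_natZ_expR_divnB1 (y : R) :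
  n.+1%:R ^+ 2 * (expR (y / n.+1%:R ^+ 2) - 1) @[n --> \oo] --> y.
Proof.
have cv : y * expR (y / n.+1%:R ^+ 2) @[n --> \oo] --> y.
  suff : y * expR (y / n.+1%:R ^+ 2) @[n --> \oo] --> y * expR (y * (0 * 0)).
    by rewrite !mulr0 expR0 mulr1.
  apply: cvgM; first exact: cvg_cst.
  apply: (cvg_comp (fun n => y / n.+1%:R ^+ 2)); last exact: continuous_expR.
  apply: cvgM; first exact: cvg_cst.
  rewrite (_ : (fun n : nat => _) = fun n => n.+1%:R^-1 * n.+1%:R^-1).
    by apply: cvgM; exact: cvg_harmonic.
  by apply/funext => n; rewrite -invfM expr2.
apply: (squeeze_cvgr _ (cvg_cst y) cv); apply: nearW => n.
have n0 : 0 < n.+1%:R ^+ 2 :> R by rewrite exprn_gt0.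
apply/andP; split.
  by rewrite -ler_pdivrMl// mulrC lerBrDl; exact: expR_ge1Dx.
have := expR_le_1DMexpR (y / n.+1%:R ^+ 2); rewrite -lerBlDl -(ler_pM2l n0).
by rewrite mulrA (mulrC (n.+1%:R ^+ 2) (y / _)) divfK// gt_eqF.
Qed.

Lemma norm_natZ_expRB1_le x n :
  `|n.+1%:R * (expR (x / n.+1%:R) - 1)| <= expR (2 * `|x|).
Proof.
rewrite normrM normr_nat.
apply: (@le_trans _ _ (n.+1%:R * (`|x / n.+1%:R| * expR `|x / n.+1%:R|))).
  by rewrite ler_wpM2l// norm_expRB1.
rewrite mulrA normrM normfV normr_nat mulrCA mulfV ?pnatr_eq0// mulr1.
rewrite mulr_natl mulr2n expRD; apply: ler_pM => //; rewrite ?expR_ge0 ?normr_le_expR//.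
by rewrite ler_expR ler_piMr// invf_le1 ?ltr0n// ler1n.
Qed.

(** The second difference quotient of the moment generating function is, up to a factor tending to
    1, the square of the first one. Its limit [x^2] and its domination follow from those already
    known. *)
Lemma expR_cosh_sqr x n :
  n.+1%:R ^+ 2 * (expR (n.+1%:R^-1 * x) + expR (- n.+1%:R^-1 * x) - 2) =
  expR (- (x / n.+1%:R)) * (n.+1%:R * (expR (x / n.+1%:R) - 1)) ^+ 2.
Proof.
rewrite exprMn mulrCA; congr (_ * _); rewrite mulNr (mulrC n.+1%:R^-1).
set y := x / _; have := expRxMexpNx_1 y; set a := expR y; set b := expR (- y).
move=> ab; have -> : b * (a - 1) ^+ 2 = a * b * (a - 2) + b by ring.
by rewrite ab; ring.
Qed.

Lemma centered_normal_mean s :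
  (N s).-integrable setT (fun x : R => x%:E) /\ (\int[N s]_x x%:E = 0)%E.
Proof.
have [|||||i1 _] := @dominated_convergence _ _ _ (N s) setT measurableT
  (fun n (x : R) => (n.+1%:R * (expR (x / n.+1%:R) - 1))%:E)
  (fun x => x%:E) (fun x => (expR (2 * `|x|))%:E).
- move=> n; apply/measurable_EFinP; apply: measurable_funM => //.
  apply: measurable_funB => //; apply: measurableT_comp => //.
  exact: measurable_funM.
- exact/measurable_EFinP.
- by apply/aeW => x _; apply/cvg_EFin; [exact: nearW|exact: cvg_natZ_expR_divnB1].
- exact: expR_norm_integrable.
- by apply/aeW => x n _; rewrite lee_fin norm_natZ_expRB1_le.
move=> c1; split => //; apply: (cvg_unique _ c1) => //.
have e n : (\int[N s]_x (n.+1%:R * (expR (x / n.+1%:R) - 1))%:E =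
  (n.+1%:R^-1 * (n.+1%:R ^+ 2 * (expR (s ^+ 2 / 2 / n.+1%:R ^+ 2) - 1)))%:E)%E.
  under eq_integral do rewrite EFinM.
  have nz : n.+1%:R != 0 :> R by rewrite pnatr_eq0.
  have i2 := expRM_integrable s n.+1%:R^-1.
  have i3 : (N s).-integrable setT (cst 1%:E : R -> \bar R).
    exact: finite_measure_integrable_cst.
  rewrite integralZl//; last first.
    have := integrableB measurableT i2 i3; apply: eq_integrable => // x _.
    by rewrite /= -EFinB mulrC.
  rewrite (_ : (\int[_]_x _)%E = (expR (n.+1%:R^-1 ^+ 2 * s ^+ 2 / 2) - 1)%:E).
    have -> : n.+1%:R^-1 ^+ 2 * s ^+ 2 / 2 = s ^+ 2 / 2 / n.+1%:R ^+ 2 :> R.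
      by move: (n.+1%:R : R) nz => a a0; field.
    rewrite -EFinM; congr EFin; set E := expR _.
    by move: (n.+1%:R : R) nz => a a0; field.
  transitivity (\int[N s]_x ((expR (n.+1%:R^-1 * x))%:E - 1%:E))%E.
    by apply: eq_integral => x _; rewrite -EFinB mulrC.
  rewrite integralB// centered_normal_mgf integral_cst//.
  by rewrite (_ : (N s : {measure set _ -> \bar R}) setT = 1%E) ?mule1//; exact: probability_setT.
rewrite (_ : (fun n => _) = fun n => (n.+1%:R^-1 * (n.+1%:R ^+ 2 * (expR (s ^+ 2 / 2 / n.+1%:R ^+ 2) - 1)))%:E); last first.
  by apply/funext => n; exact: e.
apply/cvg_EFin; first exact: nearW.
rewrite -[X in _ --> X](mul0r (s ^+ 2 / 2)); apply: cvgM; first exact: cvg_harmonic.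
exact: cvg_sqr_natZ_expR_divnB1.
Qed.

Lemma centered_normal_sqr s : (\int[N s]_x (x ^+ 2)%:E = (s ^+ 2)%:E)%E.
Proof.
have [|||||i1 _] := @dominated_convergence _ _ _ (N s) setT measurableT
  (fun n (x : R) => (n.+1%:R ^+ 2 * (expR (n.+1%:R^-1 * x) + expR (- n.+1%:R^-1 * x) - 2))%:E)
  (* In the exponent, 1 comes from the factor [exp (- x / (n+1))] and 4 from the squared quotient,
     itself at most [exp (2 |x|)]. *)
  (fun x => (x ^+ 2)%:E) (fun x => (expR (5 * `|x|))%:E).
- move=> n; apply/measurable_EFinP; apply: measurable_funM => //.
  by apply: measurable_funB => //; apply: measurable_funD; apply: measurableT_comp.
- by apply/measurable_EFinP; exact: measurable_funX.
- apply/aeW => x _; apply/cvg_EFin; first exact: nearW.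
  under eq_fun do rewrite expR_cosh_sqr.
  have -> : x ^+ 2 = expR (- (x * 0)) * (x * x) :> R.
    by rewrite mulr0 oppr0 expR0 mul1r expr2.
  apply: cvgM.
    apply: (cvg_comp (fun n : nat => - (x / n.+1%:R))); last exact: continuous_expR.
    by apply: cvgN; apply: cvgM; [exact: cvg_cst|exact: cvg_harmonic].
  under eq_fun do rewrite expr2.
  by apply: cvgM; exact: cvg_natZ_expR_divnB1.
- exact: expR_norm_integrable.
- apply/aeW => x n _; rewrite lee_fin expR_cosh_sqr normrM normrX.
  rewrite (_ : 5 * `|x| = `|x| + (2 * `|x|) * 2); last by ring.
  rewrite expRD ger0_norm ?expR_ge0// expRM_natr.
  apply: ler_pM => //; rewrite ?expR_ge0 ?exprn_ge0//; last first.
    by apply: lerXn2r; rewrite ?nnegrE ?expR_ge0 ?norm_natZ_expRB1_le.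
  rewrite ler_expR; apply: le_trans (ler_norm _) _.
  by rewrite normrN normrM normfV normr_nat ler_piMr// invf_le1 ?ltr0n// ler1n.
move=> c1; apply: (cvg_unique _ c1) => //.
have e n : (\int[N s]_x (n.+1%:R ^+ 2 * (expR (n.+1%:R^-1 * x) + expR (- n.+1%:R^-1 * x) - 2))%:E =
  (2 * (n.+1%:R ^+ 2 * (expR (s ^+ 2 / 2 / n.+1%:R ^+ 2) - 1)))%:E)%E.
  have nz : n.+1%:R != 0 :> R by rewrite pnatr_eq0.
  have i2 := expRM_integrable s n.+1%:R^-1.
  have i4 := expRM_integrable s (- n.+1%:R^-1).
  have i3 : (N s).-integrable setT (cst 2%:E : R -> \bar R).
    exact: finite_measure_integrable_cst.
  have i5 := integrableD measurableT i2 i4.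
  transitivity (\int[N s]_x ((n.+1%:R ^+ 2)%:E * ((expR (n.+1%:R^-1 * x))%:E +
      (expR (- n.+1%:R^-1 * x))%:E - 2%:E)))%E; first exact: eq_integral.
  rewrite integralZl//; last exact: (integrableB measurableT i5 i3).
  rewrite integralB// integralD// !centered_normal_mgf integral_cst//.
  rewrite (_ : (N s : {measure set _ -> \bar R}) setT = 1%E); last exact: probability_setT.
  rewrite mule1 -!EFinD -EFinM; congr EFin.
  have e1 : n.+1%:R^-1 ^+ 2 * s ^+ 2 / 2 = s ^+ 2 / 2 / n.+1%:R ^+ 2 :> R.
    by move: (n.+1%:R : R) nz => a a0; field.
  have e2 : (- n.+1%:R^-1) ^+ 2 * s ^+ 2 / 2 = s ^+ 2 / 2 / n.+1%:R ^+ 2 :> R.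
    by move: (n.+1%:R : R) nz => a a0; field.
  by rewrite e1 e2; ring.
rewrite (_ : (fun n => _) = fun n => (2 * (n.+1%:R ^+ 2 * (expR (s ^+ 2 / 2 / n.+1%:R ^+ 2) - 1)))%:E); last first.
  by apply/funext => n; exact: e.
apply/cvg_EFin; first exact: nearW.
have s2 : 2 * (s ^+ 2 / 2) = s ^+ 2 by field.
by rewrite -[X in _ --> X]s2; apply: cvgM; [exact: cvg_cst|exact: cvg_sqr_natZ_expR_divnB1].
Qed.

(** From [y^4 <= 4! (exp y + exp (- y))] at [y = x / s]. Each exponential then has integral
    [exp (1/2) <= 2], whence [96 = 24 * 2 * 2]; the value of the constant is immaterial, its
    independence of [s] is what counts. *)
Lemma centered_normal_pow4_le s : (\int[N s]_x (x ^+ 4)%:E <= (96 * s ^+ 4)%:E)%E.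
Proof.
have [->|s0] := eqVneq s 0.
  rewrite /centered_normal eqxx integral_dirac//; last first.
    by apply/measurable_EFinP; exact: measurable_funX.
  by rewrite diracT mul1e !expr0n mulr0.
have s4 : 0 < s ^+ 4 by rewrite exprn_even_gt0.
have i1 := expRM_integrable s s^-1; have i2 := expRM_integrable s (- s^-1).
have bnd (x : R) : x ^+ 4 <= 24 * s ^+ 4 * (expR (s^-1 * x) + expR (- s^-1 * x)).
  have h (y : R) : y ^+ 4 <= 24 * (expR y + expR (- y)).
    have [/expR_ge1Dxn-/(_ 3)|/ltW y0] := leP 0 y.
      by have := expR_ge0 (- y); rewrite (_ : 4`! = 24)//; lra.
    have /expR_ge1Dxn-/(_ 3) : 0 <= - y by rewrite oppr_ge0.
    have -> : (- y) ^+ 4 = y ^+ 4 by ring.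
    by have := expR_ge0 y; rewrite (_ : 4`! = 24)//; lra.
  have := h (s^-1 * x); rewrite exprMn exprVn -(ler_pM2l s4) mulrA mulfV ?gt_eqF// mul1r.
  by move=> /le_trans; apply; rewrite mulNr mulrCA mulrA.
apply: (@le_trans _ _ (\int[N s]_x ((24 * s ^+ 4)%:E * ((expR (s^-1 * x))%:E + (expR (- s^-1 * x))%:E)))%E).
  apply: ge0_le_integral => //.
  - by move=> x _; rewrite lee_fin exprn_even_ge0.
  - by apply/measurable_EFinP; exact: measurable_funX.
  - by have := integrableZl measurableT (24 * s ^+ 4) (integrableD measurableT i1 i2) => /measurable_int.
  - by move=> x _; rewrite -EFinD -EFinM lee_fin.
rewrite integralZl//; last exact: integrableD.
rewrite integralD// !centered_normal_mgf -EFinD -EFinM lee_fin.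
have -> : s^-1 ^+ 2 * s ^+ 2 / 2 = 2^-1 by field; rewrite s0.
have -> : (- s^-1) ^+ 2 * s ^+ 2 / 2 = 2^-1 by field; rewrite s0.
have := expR_le_1DMexpR (2^-1 : R); nra.
Qed.

End centered_normal_moments.

Section gaussian_variable.
Context d (T : measurableType d) (R : realType) (P : probability T R).
Variables (X : T -> measurableTypeR R) (s : R).
Hypothesis mX : measurable_fun setT X.
Hypothesis XE : forall B : set (measurableTypeR R), measurable B ->
  P (X @^-1` B) = centered_normal s B.

Lemma gaussian_mgf t :
  (\int[P]_x (expR (t * X x))%:E = (expR (t ^+ 2 * s ^+ 2 / 2))%:E)%E.
Proof.
rewrite -centered_normal_mgf.
apply: (@ge0_integral_law _ _ _ _ _ P _ X mX XE (fun y => (expR (t * y))%:E)).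
  by apply/measurable_EFinP; apply: measurableT_comp.
by move=> x; rewrite lee_fin expR_ge0.
Qed.

Lemma gaussian_sqr : (\int[P]_x (X x ^+ 2)%:E = (s ^+ 2)%:E)%E.
Proof.
rewrite -centered_normal_sqr.
apply: (@ge0_integral_law _ _ _ _ _ P _ X mX XE (fun y => (y ^+ 2)%:E)).
  by apply/measurable_EFinP; exact: measurable_funX.
by move=> x; rewrite lee_fin sqr_ge0.
Qed.

Lemma gaussian_pow4_le : (\int[P]_x (X x ^+ 4)%:E <= (96 * s ^+ 4)%:E)%E.
Proof.
apply: le_trans (centered_normal_pow4_le s).
rewrite (@ge0_integral_law _ _ _ _ _ P _ X mX XE (fun y => (y ^+ 4)%:E))//.
  by apply/measurable_EFinP; exact: measurable_funX.
by move=> x; rewrite lee_fin exprn_even_ge0.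
Qed.

(* By the fourth moment bound, a Gaussian variable keeps half of its variance on
   any event of probability close enough to 1. *)
Lemma gaussian_sqr_restrict (K : R) (B : set T) : 0 < K ->
  (\int[P]_x (X x ^+ 4)%:E <= (K * s ^+ 4)%:E)%E ->
  measurable B -> (P (~` B) <= ((4 * K)^-1)%:E)%E ->
  ((s ^+ 2)%:E <= 2%:E * \int[P]_(x in B) (X x ^+ 2)%:E)%E.
Proof.
move=> K0 X4 mB PB; have [->|s0] := eqVneq s 0.
  rewrite expr0n/=; apply: mule_ge0 => //; apply: integral_ge0 => x _.
  by rewrite lee_fin sqr_ge0.
have s2 : 0 < s ^+ 2 by rewrite exprn_even_gt0.
have mX2 n (D : set T) : measurable_fun D (fun x => (X x ^+ n)%:E).
  by apply/measurable_funTS/measurable_EFinP; exact: measurable_funX.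
have X20 (D : set T) x : D x -> (0 <= (X x ^+ 2)%:E)%E by rewrite lee_fin sqr_ge0.
have X40 (D : set T) x : D x -> (0 <= (X x ^+ 4)%:E)%E by rewrite lee_fin exprn_even_ge0.
have bnd : (\int[P]_(x in ~` B) (X x ^+ 2)%:E <= (s ^+ 2 / 2)%:E)%E.
  (* With [a = 1 / (4 K s^2)], the inequality [X^2 <= a X^4 + K s^2] says that
     [a (X^2 - 2 K s^2)^2 >= 0]. Integrated over the complement of [B], each term on the right is at
     most [s^2 / 4]. *)
  have [a [a0 aE]] : exists a : R, 0 <= a /\ a * (4 * K * s ^+ 2) = 1.
    have K4 : 0 < 4 * K * s ^+ 2 by rewrite mulr_gt0// mulr_gt0.
    by exists (4 * K * s ^+ 2)^-1; rewrite invr_ge0 (ltW K4) mulVf// gt_eqF.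
  have Ks : 0 <= K * s ^+ 2 by rewrite mulr_ge0// ltW.
  apply: (@le_trans _ _ (\int[P]_(x in ~` B)
    (a%:E * (X x ^+ 4)%:E + (K * s ^+ 2)%:E))%E).
    apply: ge0_le_integral => //.
    - exact: measurableC.
    - exact: X20.
    - by apply: emeasurable_funD => //; apply: measurable_funeM.
    move=> x _; rewrite -EFinM -EFinD lee_fin -subr_ge0.
    have -> : a * X x ^+ 4 + K * s ^+ 2 - X x ^+ 2 = a * (X x ^+ 2 - 2 * K * s ^+ 2) ^+ 2.
      have -> : a * (X x ^+ 2 - 2 * K * s ^+ 2) ^+ 2 = a * X x ^+ 4
        - a * (4 * K * s ^+ 2) * X x ^+ 2 + a * (4 * K * s ^+ 2) * (K * s ^+ 2) by ring.
      by rewrite aE; ring.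
    by rewrite mulr_ge0 ?sqr_ge0.
  have mCB := measurableC mB.
  rewrite (ge0_integralD _ mCB); last 4 first.
  - by move=> x Bx; rewrite mule_ge0 ?lee_fin//; exact: X40 Bx.
  - by apply: measurable_funeM.
  - by move=> x _; rewrite lee_fin.
  - exact: measurable_cst.
  rewrite ge0_integralZl//; last exact: X40.
  rewrite integral_cst//.
  have -> : s ^+ 2 / 2 = a * (K * s ^+ 4) + K * s ^+ 2 * (4 * K)^-1.
    have -> : a * (K * s ^+ 4) = a * (4 * K * s ^+ 2) * (s ^+ 2 / 4) by field.
    by rewrite aE; field; rewrite gt_eqF.
  rewrite EFinD; apply: leeD.
    rewrite [leRHS]EFinM; apply: lee_wpmul2l; first by rewrite lee_fin.
    apply: le_trans X4; apply: ge0_subset_integral => //.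
    exact: X40.
  by rewrite [leRHS]EFinM; apply: lee_wpmul2l => //; rewrite lee_fin.
have := gaussian_sqr; rewrite -(setUv B) ge0_integral_setU//; last 3 first.
- exact: measurableC.
- exact: X20.
- by apply/disj_setPCl.
move=> E; have {E} : ((s ^+ 2)%:E <= \int[P]_(x in B) (X x ^+ 2)%:E + (s ^+ 2 / 2)%:E)%E.
  by rewrite -E leeD2l.
have : (0 <= \int[P]_(x in B) (X x ^+ 2)%:E)%E by apply: integral_ge0; exact: X20.
case: (\int[P]_(x in B) _)%E => [r| |]//=; last by rewrite gt0_muley ?lte_fin// leey.
by rewrite -EFinD -EFinM !lee_fin; lra.
Qed.

End gaussian_variable.

Section gaussian_measure.
Context {R : realType} {V : hilbertType R}.
Variable Pi : probability (borel V) R.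
Hypothesis sepV : separable V.
Hypothesis Pi_gaussian : gaussian_centered Pi.

Lemma probability_norm_tight (e : R) : 0 < e -> exists2 r : R, 0 <= r &
  (Pi (~` [set f : borel V | (`|(f : V)| <= r)%R]) <= e%:E)%E.
Proof.
move=> e0; pose A (n : nat) := ~` [set f : borel V | `|(f : V)| <= n%:R].
have mA n : measurable (A n).
  apply: measurableC; have := @measurable_hnorm R V measurableT _ (measurable_itv `]-oo, n%:R]).
  by rewrite setTI; congr measurable; apply/seteqP; split => x /=; rewrite in_itv.
have A0 : \bigcap_n A n = set0.
  rewrite -subset0 => f /= Af.
  have [n fn] : exists n : nat, `|(f : V)| <= n%:R.
    exists (Num.bound `|(f : V)|); rewrite ltW//.
    by have := archi_boundP (normr_ge0 (f : V)).
  by have := Af n I.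
have : Pi (A n) @[n --> \oo] --> Pi (\bigcap_n A n).
  apply: nonincreasing_cvg_mu => //.
  - by rewrite -ge0_fin_numE// fin_num_measure.
  - by rewrite A0.
  - move=> m n mn; apply/subsetPset => f; apply: contra_not => /= /le_trans; apply.
    by rewrite ler_nat.
rewrite A0 measure0 => /fine_cvgP[_] /cvgr_le /(_ e e0)[n _ /(_ n (leqnn n))] /= h.
have fA : Pi (A n) \is a fin_num by exact: fin_num_measure.
by exists n%:R; [exact: ler0n|rewrite -[X in (X <= _)%E](fineK fA) lee_fin].
Qed.

Let gaussianP h : exists s : R, forall B : set (measurableTypeR R), measurable B ->
  Pi ((fun f : borel V => inner (f : V) h) @^-1` B) = centered_normal s B.
Proof. exact: Pi_gaussian. Qed.

(** Take a ball of radius [r] whose complement has probability at most [1 / (4 * 96)]. Every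
    functional [<f, h>] keeps half of its second moment on this ball, whatever [h]. Summing over the
    Gram-Schmidt vectors, Bessel's inequality bounds the part on the ball by [r^2] at every stage,
    and monotone convergence gives [2 r^2] as a bound for the whole norm. *)
Lemma gaussian_norm_sqr_lty : (\int[Pi]_f (`|(f : V)| ^+ 2)%:E < +oo)%E.
Proof.
have [d dd] := separable_dense_seq sepV.
have [r r0 Br] := @probability_norm_tight ((4 * 96)^-1) ltac:(by rewrite invr_gt0 mulr_gt0).
set B := [set f : borel V | _] in Br.
have mB : measurable B.
  have := @measurable_hnorm R V measurableT _ (measurable_itv `]-oo, r]).
  by rewrite setTI; congr measurable; apply/seteqP; split => x /=; rewrite in_itv.
have mi2 h (D : set (borel V)) : measurable_fun D (fun f : borel V => (inner (f : V) h ^+ 2)%:E).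
  by apply/measurable_funTS/measurable_EFinP/measurable_funX; exact: measurable_inner.
have i0 h (D : set (borel V)) f : D f -> (0 <= (inner (f : V) h ^+ 2)%:E)%E.
  by rewrite lee_fin sqr_ge0.
have half h : (\int[Pi]_f (inner (f : V) h ^+ 2)%:E <=
    2%:E * \int[Pi]_(f in B) (inner (f : V) h ^+ 2)%:E)%E.
  have [s hs] := gaussianP h.
  rewrite (gaussian_sqr (measurable_inner h) hs).
  apply: (gaussian_sqr_restrict (measurable_inner h) hs (K := 96)) => //.
  exact: gaussian_pow4_le (measurable_inner h) hs.
pose S n (f : borel V) := \sum_(e <- gram_schmidt d n) inner (f : V) e ^+ 2.
have mS n (D : set (borel V)) : measurable_fun D (fun f => (S n f)%:E).
  by apply/measurable_EFinP/measurable_sum => e; apply/measurable_EFinP; exact: mi2.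
have S0 n f : 0 <= S n f by apply: sumr_ge0 => e _; exact: sqr_ge0.
have SB n : (\int[Pi]_f (S n f)%:E <= (2 * r ^+ 2)%:E)%E.
  apply: (@le_trans _ _ (2%:E * \int[Pi]_(f in B) (S n f)%:E)%E).
    under eq_integral do rewrite /S -sumEFin.
    under [in leRHS]eq_integral do rewrite /S -sumEFin.
    rewrite !ge0_integral_sum//; try by move=> *; rewrite lee_fin sqr_ge0.
    rewrite ge0_sume_distrr; last by move=> e _; apply: integral_ge0; exact: i0.
    by apply: lee_sum => e _.
  rewrite EFinM; apply: lee_wpmul2l => //.
  apply: (@le_trans _ _ (\int[Pi]_(f in B) (cst (r ^+ 2)%:E f))%E).
    apply: ge0_le_integral => //.
    - by move=> f _; rewrite lee_fin.
    move=> f Bf; rewrite lee_fin; apply: le_trans (gram_schmidt_bessel d n f) _.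
    by apply: lerXn2r; rewrite ?nnegrE.
  rewrite integral_cst//= -[leRHS]mule1; apply: lee_wpmul2l => //.
    by rewrite lee_fin sqr_ge0.
  exact: probability_le1.
apply: (@le_lt_trans _ _ (2 * r ^+ 2)%:E); last exact: ltry.
have nd f : {homo (fun n => (S n f)%:E) : n m / (n <= m)%N >-> (n <= m)%E}.
  apply/nondecreasing_seqP => n; rewrite lee_fin /S/= -cats1 big_cat big_seq1/=.
  by rewrite lerDl sqr_ge0.
have := @cvg_monotone_convergence _ _ _ Pi setT measurableT
  (fun n f => (S n f)%:E) (fun n => mS n setT).
move=> /(_ (fun n f _ => S0 n f)) /(_ (fun f _ => nd f)).
have -> : (\int[Pi]_f limn (fun n => (S n f)%:E) = \int[Pi]_f (`|(f : V)| ^+ 2)%:E)%E.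
  apply: eq_integral => f _; apply/cvg_lim => //; apply/cvg_EFin; first exact: nearW.
  exact: cvg_gram_schmidt.
move=> cv; rewrite -(cvg_lim _ cv)//; apply: lime_le; first by apply: cvgP cv.
exact: nearW.
Qed.

End gaussian_measure.

Lemma ge0_eq_int d (T : measurableType d) (R : realType)
    (mu nu : {measure set T -> \bar R}) (F : T -> R) : measurable_fun setT F ->
  (forall x, 0 <= F x) -> (\int[mu]_x (F x)%:E < +oo)%E ->
  (\int[mu]_x (F x)%:E = \int[nu]_x (F x)%:E)%E -> eq_int mu nu F.
Proof.
move=> mF F0 Foo E; have mFE : measurable_fun setT (EFin \o F) by exact/measurable_EFinP.
split => //; apply/integrableP; split => //.
- by under eq_integral do rewrite /= ger0_norm//.
- by under eq_integral do rewrite /= ger0_norm//; rewrite -E.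
Qed.

Section riesz.
Context {R : realType} {V : hilbertType R}.

Lemma riesz_representation (F : V -> R) (K : R) :
  (forall f g, F (f + g) = F f + F g) -> (forall a f, F (a *: f) = a * F f) ->
  (forall f, `|F f| <= K * `|f|) -> exists u, forall h, inner u h = F h.
Proof.
move=> FD FZ FK; apply: (@bilinear_solve R V inner F 1 1 K) => //.
- by move=> f g h; exact: innerDl.
- by move=> a f h; exact: innerZl.
- exact: innerC.
- by move=> f; rewrite mul1r inner_sqnorm.
- by move=> f g; rewrite mul1r norm_inner_le.
Qed.

End riesz.

Section covariance.
Context {R : realType} {V : hilbertType R}.
Variable mu : probability (borel V) R.

(** For a centred measure, the form of the covariance operator [Q]. The operator is never formed:
    [v = Q h] is expressed by [inner v a = cov h a] for all [a], and [cov_riesz] provides such a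
    [v]. *)
Definition cov (a b : V) : R :=
  fine (\int[mu]_f (inner (f : V) a * inner (f : V) b)%:E)%E.

Hypothesis mu2 : (\int[mu]_f (`|(f : V)| ^+ 2)%:E < +oo)%E.

Lemma measurable_inner_prod a b (D : set (borel V)) :
  measurable_fun D (fun f : borel V => (inner (f : V) a * inner (f : V) b)%:E).
Proof.
apply/measurable_funTS/measurable_EFinP.
by apply: measurable_funM; exact: measurable_inner.
Qed.

Lemma integrable_hnorm_sqr :
  mu.-integrable [set: borel V] (fun f : borel V => (`|(f : V)| ^+ 2)%:E).
Proof.
apply/integrableP; split.
  by apply/measurable_EFinP/measurable_funX; exact: measurable_hnorm.
by under eq_integral do rewrite gee0_abs ?lee_fin ?exprn_ge0//.
Qed.

Lemma norm_inner_prod_le (f a b : V) :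
  `|inner f a * inner f b| <= `|a| * `|b| * `|f| ^+ 2.
Proof.
have -> : `|a| * `|b| * `|f| ^+ 2 = (`|f| * `|a|) * (`|f| * `|b|) by ring.
by rewrite normrM ler_pM// norm_inner_le.
Qed.

Lemma integrable_inner_prod a b :
  mu.-integrable [set: borel V] (fun f : borel V => (inner (f : V) a * inner (f : V) b)%:E).
Proof.
have := integrableZl measurableT (`|a| * `|b|) integrable_hnorm_sqr.
apply: le_integrable => //; first exact: measurable_inner_prod.
move=> f _; rewrite -EFinM lee_fin [leRHS]ger0_norm ?mulr_ge0 ?exprn_ge0//.
exact: norm_inner_prod_le.
Qed.

Lemma covE a b :
  (\int[mu]_f (inner (f : V) a * inner (f : V) b)%:E = (cov a b)%:E)%E.
Proof. by rewrite fineK// integrable_fin_num//; exact: integrable_inner_prod. Qed.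

Lemma covC a b : cov a b = cov b a.
Proof. by rewrite /cov; under eq_integral do rewrite mulrC. Qed.

Lemma covDl a b c : cov (a + b) c = cov a c + cov b c.
Proof.
apply: EFin_inj; rewrite EFinD -!covE -integralD//; try exact: integrable_inner_prod.
by apply: eq_integral => f _; rewrite -EFinD innerDr mulrDl.
Qed.

Lemma covZl (t : R) a b : cov (t *: a) b = t * cov a b.
Proof.
apply: EFin_inj; rewrite EFinM -!covE -integralZl//; last exact: integrable_inner_prod.
by apply: eq_integral => f _; rewrite -EFinM innerZr mulrA.
Qed.

Lemma cov_ge0 a : 0 <= cov a a.
Proof.
by rewrite -lee_fin -covE; apply: integral_ge0 => f _; rewrite lee_fin -expr2 sqr_ge0.
Qed.

Lemma cov_bounded a b :
  `|cov a b| <= fine (\int[mu]_f (`|(f : V)| ^+ 2)%:E)%E * `|a| * `|b|.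
Proof.
rewrite -lee_fin -abse_EFin -covE.
apply: le_trans (le_abse_integral _ measurableT _) _.
  exact: measurable_inner_prod.
rewrite -mulrA mulrC EFinM fineK; last first.
  by apply: integrable_fin_num => //; exact: integrable_hnorm_sqr.
have m2 : measurable_fun [set: borel V] (fun f : borel V => (`|(f : V)| ^+ 2)%:E).
  by apply/measurable_EFinP/measurable_funX; exact: measurable_hnorm.
rewrite -(ge0_integralZl _ measurableT m2)//.
apply: ge0_le_integral => //.
- by apply: measurableT_comp => //; exact: measurable_inner_prod.
- apply: measurable_funeM; apply/measurable_EFinP/measurable_funX; exact: measurable_hnorm.
- by move=> f _; rewrite -EFinM lee_fin norm_inner_prod_le.
Qed.

Lemma cov_riesz h : exists v, forall a, inner v a = cov h a.
Proof.
have := @riesz_representation R V (cov h)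
  (fine (\int[mu]_f (`|(f : V)| ^+ 2)%:E)%E * `|h|).
apply.
- by move=> f g; rewrite covC covDl !(covC h).
- by move=> a f; rewrite covC covZl (covC h).
- exact: cov_bounded.
Qed.

End covariance.

(** * The Cameron-Martin formula for shifts in the range of the covariance operator *)

Section cameron_martin.
Context {R : realType} {V : hilbertType R}.
Variable Pi : probability (borel V) R.
Hypothesis sepV : separable V.
Hypothesis Pi_gaussian : gaussian_centered Pi.
Local Notation cov := (cov Pi).
Let Pi2 := gaussian_norm_sqr_lty sepV Pi_gaussian.

Lemma gaussian_inner_mgf h :
  (\int[Pi]_f (expR (inner (f : V) h))%:E = (expR (cov h h / 2))%:E)%E.
Proof.
have [s hs] : exists s : R, forall B : set (measurableTypeR R), measurable B ->
  Pi ((fun f : borel V => inner (f : V) h) @^-1` B) = centered_normal s B by exact: Pi_gaussian.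
have := gaussian_mgf (measurable_inner h) hs 1.
under eq_integral do rewrite mul1r.
move=> ->; congr (expR (_ / 2))%:E; rewrite expr1n mul1r; apply: EFin_inj.
rewrite -(gaussian_sqr (measurable_inner h) hs) -covE//.
Qed.

(** The image of [Pi] under the translation and the measure with the stated density have the same
    exponential moments: expanding [cov (a + h) (a + h)], the cross term [cov h a] is exactly the
    shift [<v, a>]. For [v] in the range of [Q] the density is an explicit exponential of a
    continuous functional. *)
Lemma cameron_martin (h v : V) (F : borel V -> \bar R) :
  (forall a, inner v a = cov h a) ->
  measurable_fun [set: borel V] F -> (forall f, 0 <= F f)%E ->
  (\int[Pi]_f F ((f : V) + v : borel V)%R =
   \int[Pi]_f (F f * (expR (inner (f : V) h - cov h h / 2))%:E))%E.
Proof.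
move=> vh mF F0.
pose tau (f : borel V) : borel V := (f : V) + v.
have mtau : measurable_fun [set: borel V] tau.
  apply: continuous_borel_measurable_endo => x.
  by apply: cvgD; [exact: cvg_id|exact: cvg_cst].
pose m := mfun_Sub (mem_set mtau) : {mfun borel V >-> borel V}.
pose dens (f : borel V) : R := expR (inner (f : V) h - cov h h / 2).
have mdens : measurable_fun [set: borel V] dens.
  apply: measurableT_comp => //; apply: measurable_funB => //.
  exact: measurable_inner.
have dens0 f : 0 <= dens f by exact: expR_ge0.
have densE (B : set (borel V)) : measurable B ->
    density_measure Pi dens B = (\int[Pi]_(f in B) (dens f)%:E)%E.
  by move=> _; rewrite /density_measure; case: pselect => // -[].
have i1 (H : borel V -> \bar R) : measurable_fun [set: borel V] H -> (forall f, 0 <= H f)%E ->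
    (\int[pushforward Pi m]_f H f = \int[Pi]_f H (tau f))%E.
  move=> mH H0; apply/esym/(@ge0_integral_law _ _ _ _ _ Pi (pushforward Pi m) tau) => //.
have i2 (H : borel V -> \bar R) : measurable_fun [set: borel V] H -> (forall f, 0 <= H f)%E ->
    (\int[density_measure Pi dens]_f H f = \int[Pi]_f (H f * (dens f)%:E))%E.
  by move=> mH H0; exact: ge0_integral_density.
rewrite -i1// -i2//; apply: eq_measure_integral => B mB _.
apply: (@exp_moment_unique _ _ _ (pushforward Pi m) (density_measure Pi dens)
  affine_functionals); last exact: borel_halfspaces.
- move=> _ [a [r ->]]; apply: measurable_funD => //; exact: measurable_inner.
- by exists 0, 0; apply/funext => x; rewrite inner0r addr0.
- move=> _ _ [a [r ->]] [a' [r' ->]]; exists (a + a'), (r + r').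
  by apply/funext => x; rewrite innerDr; ring.
- move=> _ q [a [r ->]]; exists (ratr q *: a), (ratr q * r).
  by apply/funext => x; rewrite innerZr mulrDr.
move=> _ [a [r ->]].
have mg : measurable_fun [set: borel V] (fun f : borel V => expR (inner (f : V) a + r)).
  apply: measurableT_comp => //; apply: measurable_funD => //.
  exact: measurable_inner.
have mgE : measurable_fun [set: borel V] (fun f : borel V => (expR (inner (f : V) a + r))%:E).
  exact/measurable_EFinP.
have me (b : V) : measurable_fun [set: borel V] (fun f : borel V => (expR (inner (f : V) b))%:E).
  by apply/measurable_EFinP/measurableT_comp => //; exact: measurable_inner.
have e1 : (\int[pushforward Pi m]_f (expR (inner (f : V) a + r))%:E =
    (expR (inner v a + r + cov a a / 2))%:E)%E.
  rewrite i1//; under eq_integral.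
    move=> f _; rewrite /tau innerDl -addrA addrC expRD EFinM; over.
  by rewrite ge0_integralZl// gaussian_inner_mgf -EFinM -expRD.
apply: ge0_eq_int => //.
  by rewrite e1 ltry.
rewrite e1 i2//.
transitivity (\int[Pi]_f ((expR (r - cov h h / 2))%:E * (expR (inner (f : V) (a + h)))%:E))%E.
  rewrite ge0_integralZl// gaussian_inner_mgf -EFinM -expRD; congr (expR _)%:E.
  rewrite vh !covDl// ![cov _ (a + h)]covC !covDl// (covC _ a h).
  by field.
by apply: eq_integral => f _; rewrite -!EFinM -!expRD innerDr; congr (expR _)%:E; ring.
Qed.

End cameron_martin.

(** * White noise *)

Section ae_sections.
Context d1 d2 (T1 : measurableType d1) (T2 : measurableType d2) (R : realType).
Variables (mu : probability T1 R) (nu : probability T2 R).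

Lemma ge0_ae_section_lty (F : T1 * T2 -> \bar R) : measurable_fun setT F ->
  (forall z, 0 <= F z)%E -> (\int[mu]_x \int[nu]_y F (x, y) < +oo)%E ->
  {ae nu, forall y, (\int[mu]_x F (x, y) < +oo)%E}.
Proof.
move=> mF F0 Foo.
have mG : measurable_fun setT (fubini_G mu F) by exact: measurable_fun_fubini_tonelli_G.
have iG : nu.-integrable setT (fubini_G mu F).
  apply/integrableP; split => //.
  under eq_integral => y _ do rewrite gee0_abs ?integral_ge0//.
  by rewrite /fubini_G -fubini_tonelli.
have := integrable_ae measurableT iG.
by apply: filterS => y /(_ Logic.I); rewrite ge0_fin_numE// integral_ge0.
Qed.

(** The null set in the hypothesis depends on [x]. Tonelli applied to [|u1 - u2|] exchanges the two
    quantifiers; joint measurability of the likelihood version serves this purpose. *)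
Lemma ae_sections_eq (u1 u2 : T1 * T2 -> R) :
  measurable_fun setT u1 -> measurable_fun setT u2 ->
  (forall x, {ae nu, forall y, u1 (x, y) = u2 (x, y)}) ->
  {ae nu, forall y, {ae mu, forall x, u1 (x, y) = u2 (x, y)}}.
Proof.
move=> m1 m2 u12; pose F z := (`|u1 z - u2 z|)%:E : \bar R.
have mF : measurable_fun setT F.
  by apply/measurable_EFinP/measurableT_comp => //; exact: measurable_funB.
have F0 z : (0 <= F z)%E by rewrite lee_fin.
have F1 x : measurable_fun setT (fun y => F (x, y)) by exact: measurable_fun_pair2.
have F2 y : measurable_fun setT (fun x => F (x, y)) by exact: measurable_fun_pair1.
have E : (\int[nu]_y \int[mu]_x F (x, y) = 0)%E.
  rewrite -fubini_tonelli//; apply: integral0_eq => x _.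
  rewrite (ge0_ae_eq_integral _ (F1 x) (measurable_cst 0%E))//; first by rewrite integral0.
  by apply: filterS (u12 x) => y xy _; rewrite /F xy subrr normr0.
have mG : measurable_fun setT (fubini_G mu F) by exact: measurable_fun_fubini_tonelli_G.
have : (\int[nu]_y `|fubini_G mu F y| = 0)%E.
  by under eq_integral => y _ do rewrite gee0_abs ?integral_ge0//.
move=> /(ae_eq_integral_abs nu measurableT mG).
apply: filterS => y /(_ Logic.I); rewrite /fubini_G/= => G0.
have : (\int[mu]_x `|F (x, y)| = 0)%E.
  by under eq_integral do rewrite gee0_abs//.
move=> /(ae_eq_integral_abs mu measurableT (F2 y)).
by apply: filterS => x /(_ Logic.I) [] /normr0_eq0 /subr0_eq.
Qed.

End ae_sections.

Section white_noise_theory.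
Context d (Omega : measurableType d) (R : realType) (P : probability Omega R).
Context {V : hilbertType R}.
Variable W : V -> {RV P >-> R}.
Hypothesis W_noise : white_noise W.

Lemma white_noise_inner a b : (\int[P]_w (W a w * W b w)%:E = (inner a b)%:E)%E.
Proof. by have [_ /(_ a b)] := W_noise; rewrite unlock. Qed.

Lemma measurable_white_noise a : measurable_fun setT (W a : Omega -> measurableTypeR R).
Proof. exact: (@measurable_funPT _ _ _ _ (W a)). Qed.

Lemma white_noise_gaussian a (B : set (measurableTypeR R)) : measurable B ->
  P (W a @^-1` B) = centered_normal `|a| B.
Proof.
move=> mB; have [/(_ 1%N (fun=> a) (fun=> 1)) [s hs] _] := W_noise.
have e : (fun w => \sum_(i < 1) 1 * W a w) = W a.
  by apply/funext => w; rewrite big_ord_recl big_ord0 addr0 mul1r.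
rewrite e {e} in hs.
rewrite (hs _ mB); have : s ^+ 2 = `|a| ^+ 2.
  apply: EFin_inj; rewrite -inner_sqnorm -white_noise_inner.
  rewrite -(gaussian_sqr (measurable_white_noise a) hs).
  by apply: eq_integral => w _; rewrite expr2.
(* The second moment determines [s] only up to sign, and the normal density depends on [s] only
   through its square. *)
move=> /eqP; rewrite eqf_sqr => /orP[/eqP->//|/eqP ->].
rewrite /centered_normal oppr_eq0; case: ifPn => [_|a0]; first reflexivity.
rewrite /normal_prob; apply: eq_integral => x _.
rewrite !normal_pdfE ?oppr_eq0//; congr (_ * _)%:E.
  by rewrite /normal_peak sqrrN.
by rewrite /normal_fun sqrrN.
Qed.

Lemma white_noise_mgf a t :
  (\int[P]_w (expR (t * W a w))%:E = (expR (t ^+ 2 * `|a| ^+ 2 / 2))%:E)%E.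
Proof. exact: (gaussian_mgf (measurable_white_noise a) (@white_noise_gaussian a)). Qed.

Lemma white_noise_integrable a b : P.-integrable setT (fun w => (W a w * W b w)%:E).
Proof.
have i2 c : P.-integrable setT (fun w => (W c w * W c w)%:E).
  apply/integrableP; split; first by apply/measurable_EFinP/measurable_funM.
  under eq_integral => w _ do rewrite gee0_abs ?lee_fin -?expr2 ?sqr_ge0//.
  by under eq_integral do rewrite expr2; rewrite white_noise_inner ltry.
have := integrableD measurableT (i2 a) (i2 b).
apply: le_integrable => //; first by apply/measurable_EFinP/measurable_funM.
move=> w _ /=; rewrite lee_fin -!expr2 (ger0_norm (addr_ge0 (sqr_ge0 _) (sqr_ge0 _))).
by rewrite ler_norml; apply/andP; split; have := sqr_ge0 (W a w + W b w);
  have := sqr_ge0 (W a w - W b w); have := sqr_ge0 (W a w); have := sqr_ge0 (W b w); nra.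
Qed.

Lemma white_noise_sum_sqr (s : seq (R * V)) :
  (\int[P]_w ((\sum_(i <- s) i.1 * W i.2 w) ^+ 2)%:E =
   (`|\sum_(i <- s) i.1 *: i.2| ^+ 2)%:E)%E.
Proof.
pose F (ij : (R * V) * (R * V)) w :=
  ((ij.1.1 * ij.2.1)%:E * (W ij.1.2 w * W ij.2.2 w)%:E)%E.
have iF ij : P.-integrable setT (F ij).
  by apply: integrableZl => //; exact: white_noise_integrable.
transitivity (\int[P]_w \sum_(ij <- [seq (i, j) | i <- s, j <- s]) F ij w)%E.
  apply: eq_integral => w _; rewrite big_allpairs/= /F.
  rewrite expr2 mulr_suml -sumEFin; apply: eq_bigr => i _.
  rewrite mulr_sumr -sumEFin; apply: eq_bigr => j _.
  by rewrite -EFinM; congr EFin; ring.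
rewrite integral_sum// big_allpairs/=.
rewrite -inner_sqnorm inner_suml -sumEFin; apply: eq_bigr => i _.
rewrite innerC inner_suml -sumEFin; apply: eq_bigr => j _.
rewrite /F integralZl//; last exact: white_noise_integrable.
by rewrite white_noise_inner -EFinM innerZl innerZr (innerC j.2); congr EFin; ring.
Qed.

(** By the isometry property the defect of linearity has second moment
    [|(a + t b) - a - t b|^2 = 0]. The null set depends on [a], [b] and [t]. *)
Lemma white_noise_linear a b t :
  {ae P, forall w, W (a + t *: b) w = W a w + t * W b w}.
Proof.
have := white_noise_sum_sqr [:: (1, a + t *: b); (-1, a); (- t, b)].
rewrite !big_cons !big_nil/= !addr0 scale1r scaleN1r scaleNr -opprD subrr normr0 expr0n/=.
move=> h; have : (\int[P]_w `|((W (a + t *: b) w - (W a w + t * W b w)) ^+ 2)%:E| = 0)%E.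
  rewrite -[RHS]h; apply: eq_integral => w _.
  rewrite gee0_abs ?lee_fin ?sqr_ge0// !big_cons big_nil/=.
  by congr (_ ^+ 2)%:E; ring.
move=> /(ae_eq_integral_abs P measurableT) h2.
have {}/h2 : measurable_fun setT (fun w => ((W (a + t *: b) w - (W a w + t * W b w)) ^+ 2)%:E).
  apply/measurable_EFinP/measurable_funX/measurable_funB => //.
  by apply: measurable_funD => //; exact: measurable_funM.
apply: filterS => w /(_ Logic.I) [] /eqP; rewrite sqrf_eq0 subr_eq0 => /eqP.
by [].
Qed.

End white_noise_theory.

(** * The posterior distribution *)

Section adjoint.
Context {R : realType} {V2 Vb : hilbertType R}.
Variables (T : {linear Vb -> V2}) (c : R).
Hypothesis T_bound : forall f, `|T f| <= c * `|f|.

Lemma adjoint_exists : exists Ts : V2 -> Vb, forall f y, inner (T f) y = inner f (Ts y).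
Proof.
suff /choice[Ts TsE] y : exists u : Vb, forall f, inner (T f) y = inner f u.
  by exists Ts.
have [] := @riesz_representation _ _ (fun f => inner (T f) y) (c * `|y|).
- by move=> f g; rewrite linearD innerDl.
- by move=> a f; rewrite linearZ innerZl.
- move=> f; apply: le_trans (norm_inner_le _ _) _.
  by rewrite mulrAC ler_wpM2r.
by move=> u uE; exists u => f; rewrite (innerC f) uE.
Qed.

Variable Ts : V2 -> Vb.
Hypothesis TsE : forall f y, inner (T f) y = inner f (Ts y).

Lemma adjointD a b : Ts (a + b) = Ts a + Ts b.
Proof. by apply: inner_ext_eq => h; rewrite innerDl !(innerC _ h) -!TsE innerDr. Qed.

Lemma adjointZ t a : Ts (t *: a) = t *: Ts a.
Proof. by apply: inner_ext_eq => h; rewrite innerZl !(innerC _ h) -!TsE innerZr. Qed.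

Lemma adjoint_bound y : 0 <= c -> `|Ts y| <= c * `|y|.
Proof.
move=> c0; have [->|Tsy0] := eqVneq `|Ts y| 0; first by rewrite mulr_ge0.
rewrite -(ler_pM2l (_ : 0 < `|Ts y|)); last by rewrite lt_neqAle eq_sym Tsy0/=.
rewrite -expr2 -inner_sqnorm -TsE; apply: le_trans (ler_norm _) _.
apply: le_trans (norm_inner_le _ _) _; rewrite mulrA [`|Ts y| * c]mulrC.
by rewrite ler_wpM2r.
Qed.

End adjoint.

Section regularized_equation.
Context {R : realType} {V2 Vb : hilbertType R}.
Variables (T : {linear Vb -> V2}) (c : R) (Ts : V2 -> Vb) (Pi : probability (borel Vb) R).
Hypothesis c_ge0 : 0 <= c.
Hypothesis T_bound : forall f, `|T f| <= c * `|f|.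
Hypothesis TsE : forall f y, inner (T f) y = inner f (Ts y).
Hypothesis Pi2 : (\int[Pi]_f (`|(f : Vb)| ^+ 2)%:E < +oo)%E.

(** The weak form of [(T Q Ts + eps^2) y = g]. Coercivity comes from the noise level alone, the
    covariance term being merely nonnegative. *)
Lemma regularized_solve (eps : R) (g : V2) : 0 < eps ->
  exists y, forall h, eps ^+ 2 * inner y h + cov Pi (Ts y) (Ts h) = inner g h.
Proof.
move=> e0; pose S := fine (\int[Pi]_f (`|(f : Vb)| ^+ 2)%:E)%E.
have S0 : 0 <= S by apply: fine_ge0; apply: integral_ge0 => f _; rewrite lee_fin exprn_ge0.
apply: (@bilinear_solve R V2 (fun y h => eps ^+ 2 * inner y h + cov Pi (Ts y) (Ts h))
  (inner g) (eps ^+ 2) (eps ^+ 2 + S * c * c) `|g|).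
- by move=> f g' h; rewrite (adjointD TsE) innerDl covDl//; ring.
- by move=> a f h; rewrite (adjointZ TsE) innerZl covZl//; ring.
- by move=> f g'; rewrite innerC covC.
- by rewrite exprn_gt0.
- by move=> f; rewrite inner_sqnorm lerDl cov_ge0.
- move=> f h; apply: le_trans (ler_normD _ _) _; rewrite mulrDl mulrDl; apply: lerD.
    by rewrite normrM ger0_norm ?sqr_ge0// -mulrA ler_wpM2l ?sqr_ge0// norm_inner_le.
  apply: le_trans (cov_bounded _ _ _) _ => //; rewrite -/S.
  have -> : S * c * c * `|f| * `|h| = S * (c * `|f|) * (c * `|h|) by ring.
  apply: ler_pM; rewrite ?mulr_ge0//; last exact: adjoint_bound.
  by apply: ler_wpM2l => //; exact: adjoint_bound.
- by move=> f h; rewrite innerDr.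
- by move=> a f; rewrite innerZr.
- exact: norm_inner_le.
Qed.

End regularized_equation.

Section posterior_moments.
Context {R : realType} {V2 Vb : hilbertType R}.
Context d (Omega : measurableType d) (P : probability Omega R).
Variables (T : {linear Vb -> V2}) (Ts : V2 -> Vb) (W : V2 -> {RV P >-> R}).
Variables (f0 : Vb) (Pi : probability (borel Vb) R) (eps : R) (q : Vb -> Omega -> R).
Hypothesis sepVb : separable Vb.
Hypothesis W_noise : white_noise W.
Hypothesis TsE : forall f y, inner (T f) y = inner f (Ts y).
Hypothesis Pi_gaussian : gaussian_centered Pi.
Hypothesis eps_gt0 : 0 < eps.
Hypothesis mq : measurable_fun [set: borel Vb * Omega] (fun x => q x.1 x.2).
Hypothesis q_ge0 : forall f w, 0 <= q f w.
Hypothesis qE : forall f, {ae P, forall w,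
  q f w = likelihood T eps (observation T W f0 eps w) f}.

Local Notation M w := (observation T W f0 eps w).
Let Pi2 := gaussian_norm_sqr_lty sepVb Pi_gaussian.

Let mq1 w : measurable_fun [set: borel Vb] (fun f : borel Vb => q f w).
Proof. exact: (measurable_fun_pair1 w mq). Qed.

Let mq2 f : measurable_fun setT (q f).
Proof. exact: (measurable_fun_pair2 (f : borel Vb) mq). Qed.

Let mTinner y : measurable_fun [set: borel Vb] (fun f : borel Vb => inner (T f) y).
Proof.
by rewrite (_ : (fun _ => _) = fun f : borel Vb => inner (f : Vb) (Ts y));
  [exact: measurable_inner|apply/funext => f; rewrite TsE].
Qed.

(** The exponential moment of [eps^-1 W (T f)] cancels the quadratic term [- |T f|^2 / (2 eps^2)] of
    the log-likelihood, leaving the exponential of a linear functional of [f]. *)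
Lemma likelihood_expectation f :
  (\int[P]_w (q f w)%:E = (expR (eps ^- 2 * inner (T f0) (T f)))%:E)%E.
Proof.
have e0 : eps != 0 by rewrite gt_eqF.
pose k := expR (eps ^- 2 * inner (T f0) (T f) - 2^-1 * eps ^- 2 * `|T f| ^+ 2).
transitivity (\int[P]_w (k%:E * (expR (eps^-1 * W (T f) w))%:E))%E.
  apply: ge0_ae_eq_integral => //.
  - exact/measurable_EFinP.
  - apply: measurable_funeM; apply/measurable_EFinP/measurableT_comp => //.
    exact: measurable_funM.
  - by move=> w _; rewrite lee_fin.
  - by move=> w _; rewrite -EFinM lee_fin mulr_ge0 ?expR_ge0.
  apply: filterS (qE f) => w -> _; rewrite /likelihood /observation/= -EFinM -expRD.
  by congr (expR _)%:E; field.
rewrite ge0_integralZl//; last 2 first.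
- by apply/measurable_EFinP/measurableT_comp => //; exact: measurable_funM.
- by rewrite lee_fin expR_ge0.
rewrite white_noise_mgf// -EFinM -expRD; congr (expR _)%:E.
by field.
Qed.

(** The summand 1 makes the normalizing constant finite and the norm makes the posterior mean exist.
    By Tonelli it is enough to integrate over the prior after averaging the likelihood over the
    noise. *)
Lemma likelihood_first_moment_lty :
  {ae P, forall w, (\int[Pi]_f ((1 + `|(f : Vb)|) * q f w)%:E < +oo)%E}.
Proof.
pose F (z : borel Vb * Omega) := ((1 + `|(z.1 : Vb)|) * q z.1 z.2)%:E : \bar R.
have mn : measurable_fun [set: borel Vb] (fun f : borel Vb => 1 + `|(f : Vb)|).
  by apply: measurable_funD => //; exact: measurable_hnorm.
have F0 z : (0 <= F z)%E by rewrite lee_fin mulr_ge0// addr_ge0.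
have mF : measurable_fun setT F.
  apply/measurable_EFinP; apply: measurable_funM => //.
  exact: (measurableT_comp mn measurable_fst).
apply: (@ge0_ae_section_lty _ _ _ _ R Pi P F) => //.
(* The factor 2 comes from bounding [(1 + |f|) a] by [2 |f|^2 + 2 + a^2], where [a] is the averaged
   likelihood: squaring [a] doubles its exponent. *)
pose h := 2 *: Ts (eps ^- 2 *: T f0).
have mh : measurable_fun [set: borel Vb] (fun f : borel Vb => (expR (inner (f : Vb) h))%:E).
  by apply/measurable_EFinP/measurableT_comp => //; exact: measurable_inner.
have mn2 : measurable_fun [set: borel Vb] (fun f : borel Vb => (2 * `|(f : Vb)| ^+ 2)%:E).
  by apply/measurable_EFinP/measurable_funM => //; apply/measurable_funX; exact: measurable_hnorm.
apply: (@le_lt_trans _ _ (\int[Pi]_f ((2 * `|(f : Vb)| ^+ 2)%:E +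
    (2%:E + (expR (inner (f : Vb) h))%:E)))%E).
  have mG : measurable_fun setT (fubini_F P F) by exact: measurable_fun_fubini_tonelli_F.
  apply: ge0_le_integral => //.
  - by move=> f _; apply: integral_ge0.
  - by apply: emeasurable_funD => //; apply: emeasurable_funD.
  move=> f _; rewrite /F/=; under eq_integral do rewrite EFinM.
  have mqf : measurable_fun setT (fun w => (q f w)%:E) by exact/measurable_EFinP.
  have qf0 w : setT w -> (0 <= (q f w)%:E)%E by rewrite lee_fin.
  have nf0 : (0 <= (1 + `|f : Vb|)%:E)%E by rewrite lee_fin addr_ge0.
  rewrite (ge0_integralZl _ measurableT mqf qf0 nf0).
  rewrite likelihood_expectation -EFinM -!EFinD lee_fin.
  have -> : expR (inner f h) = expR (eps ^- 2 * inner (T f0) (T f)) ^+ 2.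
    rewrite -expRM_natl; congr expR; rewrite /h innerZr -TsE innerZr.
    by rewrite (innerC (T f)).
  set a := expR _; set b := `|(f : Vb)|.
  by have := sqr_ge0 (1 + b - a); have := sqr_ge0 (1 - b); nra.
rewrite ge0_integralD//; last 2 first.
- by move=> f _; rewrite -EFinD lee_fin addr_ge0 ?expR_ge0.
- by apply: emeasurable_funD.
rewrite ge0_integralD// integral_cst// gaussian_inner_mgf//.
rewrite (_ : (Pi : {measure set _ -> \bar R}) setT = 1%E); last exact: probability_setT.
rewrite mule1 -EFinD lte_add_pinfty ?ltry//.
under eq_integral do rewrite EFinM.
rewrite ge0_integralZl//; last first.
  by apply/measurable_EFinP/measurable_funX; exact: measurable_hnorm.
by rewrite lte_mul_pinfty.
Qed.

(** For each [f] the version is almost surely an exponential, hence positive; exchanging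
    quantifiers, it is positive for prior-almost every [f]. A zero integral would make it vanish
    almost everywhere as well, which a probability excludes. *)
Lemma evidence_gt0 : {ae P, forall w, (0 < \int[Pi]_f (q f w)%:E)%E}.
Proof.
pose u1 (z : borel Vb * Omega) : R := \1_[set z : borel Vb * Omega | 0 < q z.1 z.2] z.
have mu1 : measurable_fun setT u1.
  apply: measurable_indic; have := mq measurableT (measurable_itv `]0, +oo[).
  by rewrite setTI; congr measurable; apply/seteqP; split => x /=; rewrite in_itv/= andbT.
have u11 f : {ae P, forall w, u1 (f, w) = 1}.
  apply: filterS (qE f) => w qw; rewrite /u1 indicE mem_set//= qw; exact: expR_gt0.
have H := @ae_sections_eq _ _ _ _ _ Pi P u1 (fun=> 1) mu1 (measurable_cst _) u11.
apply: filterS H => w H; rewrite lt_neqAle integral_ge0 ?andbT; last first.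
  by move=> f _; rewrite lee_fin.
apply/eqP => /esym E0.
have : (\int[Pi]_f `|(q f w)%:E| = 0)%E.
  by rewrite -[RHS]E0; apply: eq_integral => f _; rewrite gee0_abs ?lee_fin.
move=> /(ae_eq_integral_abs Pi measurableT) H2.
have {}/H2 H2 : measurable_fun [set: borel Vb] (fun f : borel Vb => (q f w)%:E).
  exact/measurable_EFinP.
have : {ae Pi, forall f, False}.
  apply: filterS2 H H2 => f; rewrite /u1 indicE => h /(_ Logic.I) [] q0.
  by move: h; rewrite memNset/= ?q0 ?ltxx// => /eqP; rewrite eq_sym oner_eq0.
move=> [N [mN N0 /= HN]].
have : Pi setT = 0%E.
  apply/eqP; rewrite -measure_le0 -N0; apply: le_measure; rewrite ?inE//.
  by apply: subset_trans HN => f _ [].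
by rewrite probability_setT => /eqP; rewrite onee_eq0.
Qed.

(* The likelihood is changed by a shift of its argument in an explicit way; the
   shift is undone by the Cameron-Martin formula. *)
Lemma likelihood_exp_moment (y g : V2) (v : Vb) (s : R) :
  (forall a, inner v a = cov Pi (Ts y) a) -> g = T v + eps ^+ 2 *: y ->
  {ae P, forall w, (\int[Pi]_f (expR (s * inner (T f) g) * q f w)%:E =
    (expR (s * M w (T v) + s ^+ 2 * eps ^+ 2 *
      (`|T v| ^+ 2 + eps ^+ 2 * cov Pi (Ts y) (Ts y)) / 2))%:E *
    \int[Pi]_f (q f w)%:E)%E}.
Proof.
move=> vE gE; have e0 : eps != 0 by rewrite gt_eqF.
(* The factor [eps^2] compensates the [eps^-2] of the log-likelihood, so that the shift changes it
   by [D], whose part depending on [f] is [- s <T f, T v>]. *)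
pose r := s * eps ^+ 2.
pose u1 (z : borel Vb * Omega) := q ((z.1 : Vb) + r *: v) z.2.
pose D (f : Vb) w := s * M w (T v) - s * inner (T f) (T v) - s ^+ 2 * eps ^+ 2 * `|T v| ^+ 2 / 2.
pose u2 (z : borel Vb * Omega) := q z.1 z.2 * expR (D z.1 z.2).
have mtau : measurable_fun [set: borel Vb] (fun f : borel Vb => (f : Vb) + r *: v : borel Vb).
  apply: continuous_borel_measurable_endo => x.
  by apply: cvgD; [exact: cvg_id|exact: cvg_cst].
have mu1 : measurable_fun setT u1.
  have mg : measurable_fun setT
      (fun z : borel Vb * Omega => ((z.1 : Vb) + r *: v : borel Vb, z.2)).
    apply: measurable_fun_pair => //.
    exact: (measurableT_comp mtau measurable_fst).
  exact: (measurableT_comp mq mg).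
have mu2 : measurable_fun setT u2.
  apply: measurable_funM => //; apply: measurableT_comp => //.
  apply: measurable_funB => //; apply: measurable_funB.
    apply: measurable_funM => //; apply: measurable_funD => //.
    apply: measurable_funM => //.
    exact: (measurableT_comp (measurable_funPT (W (T v))) measurable_snd).
  apply: measurable_funM => //.
  exact: (measurableT_comp (mTinner (T v)) measurable_fst).
have u12 (f : borel Vb) : {ae P, forall w, u1 (f, w) = u2 (f, w)}.
  apply: filterS3 (qE f) (qE (f + r *: v)) (white_noise_linear W_noise (T f) (T v) r).
  move=> w h1 h2 h3; rewrite /u1 /u2/= h1 h2 /likelihood -expRD; congr expR.
  rewrite /D /observation linearD linearZ/= h3 sqnormD normrZ innerDr !innerZr.
  by rewrite exprMn real_normK ?num_real// /r; field.
have H := @ae_sections_eq _ _ _ _ _ Pi P u1 u2 mu1 mu2 u12.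
apply: filterS H => w uw.
set Z := (\int[Pi]_f (q f w)%:E)%E.
have Z0 : (0 <= Z)%E by apply: integral_ge0 => f _; rewrite lee_fin.
have me a (b : V2) : measurable_fun [set: borel Vb] (fun f : borel Vb => expR (a * inner (T f) b)).
  by apply: measurableT_comp => //; exact: measurable_funM.
(* The exponential factor is there to cancel the part of [D] that depends on [f] once the argument
   is shifted. *)
pose F (f : borel Vb) := (q f w * expR (s * inner (T f) (T v)))%:E : \bar R.
have mF : measurable_fun setT F by apply/measurable_EFinP/measurable_funM.
have F0 f : (0 <= F f)%E by rewrite lee_fin mulr_ge0 ?expR_ge0.
have rvE a : inner (r *: v) a = cov Pi (r *: Ts y) a by rewrite innerZl covZl// vE.
have := cameron_martin sepVb Pi_gaussian rvE mF F0.
set k1 := s * M w (T v) + s ^+ 2 * eps ^+ 2 * `|T v| ^+ 2 / 2.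
have -> : (\int[Pi]_f F ((f : Vb) + r *: v : borel Vb)%R = (expR k1)%:E * Z)%E.
  rewrite -ge0_integralZl//; last 2 first.
  - exact/measurable_EFinP.
  - by move=> f _; rewrite lee_fin.
  apply: ge0_ae_eq_integral => //.
  - exact: (measurableT_comp mF mtau).
  - by apply: measurable_funeM; exact/measurable_EFinP.
  - by move=> f _; rewrite mule_ge0// lee_fin.
  apply: filterS uw => f; rewrite /u1 /u2/= => uf _; rewrite /F uf -EFinM; congr EFin.
  have TE : T ((f : Vb) + r *: v) = T f + r *: T v by rewrite linearD linearZ.
  rewrite -mulrA -expRD mulrC; congr (expR _ * _); rewrite /D /k1 TE.
  by rewrite innerDl innerZl inner_sqnorm /r; field.
set k2 := r ^+ 2 * cov Pi (Ts y) (Ts y) / 2.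
have -> : (\int[Pi]_f (F f * (expR (inner (f : Vb) (r *: Ts y) -
     cov Pi (r *: Ts y) (r *: Ts y) / 2))%:E) =
   (expR (- k2))%:E * \int[Pi]_f (expR (s * inner (T f) g) * q f w)%:E)%E.
  rewrite -ge0_integralZl//; last 2 first.
  - by apply/measurable_EFinP; apply: measurable_funM.
  - by move=> f _; rewrite lee_fin mulr_ge0 ?expR_ge0.
  apply: eq_integral => f _; rewrite /F -!EFinM; congr EFin.
  rewrite -mulrA -expRD mulrA -expRD mulrC; congr (expR _ * _).
  rewrite covZl// covC covZl// innerZr -TsE gE innerDr innerZr /k2 /r.
  by field.
move=> E.
have -> : s * M w (T v) + s ^+ 2 * eps ^+ 2 *
  (`|T v| ^+ 2 + eps ^+ 2 * cov Pi (Ts y) (Ts y)) / 2 = k2 + k1.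
  by rewrite /k1 /k2 /r; field.
by rewrite expRD EFinM -muleA E muleA -EFinM -expRD subrr expR0 mul1e.
Qed.

End posterior_moments.

Lemma pushforward_measure d d' (T : measurableType d) (T' : measurableType d')
    (R : realType) (mu : {measure set T -> \bar R}) (X : T -> T') :
  measurable_fun setT X -> exists nu : {measure set T' -> \bar R},
    forall B, measurable B -> mu (X @^-1` B) = nu B.
Proof.
move=> mX; pose m := mfun_Sub (mem_set mX) : {mfun T >-> T'}.
by unshelve eexists (pushforward mu m).
Qed.

Lemma mnormalizeE d (T : measurableType d) (R : realType)
    (mu : {measure set T -> \bar R}) (P : probability T R) (B : set T) :
  (0 < mu setT)%E -> (mu setT < +oo)%E ->
  mnormalize mu P B = (mu B * (fine (mu setT))^-1%:E)%E.
Proof. by move=> mu0 muoo; rewrite /mnormalize gt_eqF// lt_eqF. Qed.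

(** * Normal laws: characterization by exponential moments and weak continuity in the variance *)

Section normal_uniqueness.
Context {R : realType}.
Local Notation N s := (centered_normal s : probability (measurableTypeR R) R).

Let normal_mgf_unique (mu : {measure set (measurableTypeR R) -> \bar R}) (s : R) :
  (forall q : rat, \int[mu]_x (expR (ratr q * x))%:E =
    (expR (ratr q ^+ 2 * s ^+ 2 / 2))%:E)%E ->
  forall B : set (measurableTypeR R), measurable B -> mu B = N s B.
Proof.
move=> muE B mB.
pose G := [set g : measurableTypeR R -> R | exists (q : rat) (r : R), g = fun x => ratr q * x + r].
have mexp (q : rat) : measurable_fun setT (fun x : measurableTypeR R => (expR (ratr q * x))%:E).
  by apply/measurable_EFinP; apply: measurableT_comp.
apply: (@exp_moment_unique _ _ _ mu (N s) G).
- by move=> _ [q [r ->]]; apply: measurable_funD => //; exact: measurable_funM.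
- by exists 0, 0; apply/funext => x; rewrite rmorph0 mul0r addr0.
- move=> _ _ [q [r ->]] [q' [r' ->]]; exists (q + q'), (r + r').
  by apply/funext => x; rewrite rmorphD/=; ring.
- move=> _ q' [q [r ->]]; exists (q' * q), (ratr q' * r).
  by apply/funext => x; rewrite rmorphM/=; ring.
- move=> _ [q [r ->]].
  have e (m : {measure set (measurableTypeR R) -> \bar R}) :
      (\int[m]_x (expR (ratr q * x + r))%:E = (expR r)%:E * \int[m]_x (expR (ratr q * x))%:E)%E.
    rewrite -ge0_integralZl//.
    by apply: eq_integral => x _; rewrite -EFinM -expRD addrC.
  apply: ge0_eq_int.
  + by apply: measurableT_comp => //; apply: measurable_funD.
  + by move=> x; exact: expR_ge0.
  + by rewrite e muE -EFinM ltry.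
  + by rewrite !e muE centered_normal_mgf.
have {mB} : <<s RGenOInfty.G (R := R) >> B.
  by have mE := RGenOInfty.measurableE R; move: mB; rewrite /measurableTypeR mE.
apply: sub_sigma_algebra2.
move=> _ [a ->]; exists (fun x => ratr 1 * x + - a); first by exists 1, (- a).
by apply/seteqP; split => x /=; rewrite in_itv/= andbT rmorph1 mul1r subr_gt0.
Qed.

Lemma normal_law_unique d (T : measurableType d) (mu : {measure set T -> \bar R})
    (X : T -> measurableTypeR R) (s : R) : measurable_fun setT X ->
  (forall q : rat, \int[mu]_x (expR (ratr q * X x))%:E =
    (expR (ratr q ^+ 2 * s ^+ 2 / 2))%:E)%E ->
  forall B : set (measurableTypeR R), measurable B -> mu (X @^-1` B) = N s B.
Proof.
move=> mX muE B mB; have [nu nuE] := pushforward_measure mu mX.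
rewrite nuE//; apply: normal_mgf_unique => // q.
rewrite -(@ge0_integral_law _ _ _ _ _ mu nu X mX nuE (fun x => (expR (ratr q * x))%:E))//.
by apply/measurable_EFinP; apply: measurableT_comp.
Qed.

Lemma centered_normal_scale (s : R) (B : set (measurableTypeR R)) : measurable B ->
  N 1 ((fun x => s * x) @^-1` B) = N s B.
Proof.
move=> mB; apply: (@normal_law_unique _ (measurableTypeR R) (N 1) (fun x => s * x)) => // [|q].
  exact: measurable_funM.
under eq_integral do rewrite mulrA.
by rewrite centered_normal_mgf; congr (expR _)%:E; field.
Qed.

(** All these laws, degenerate ones included, are images of [N 1] under scalings, so weak
    convergence reduces to dominated convergence under one fixed law. *)
Lemma weak_cvg_centered_normal (u : nat -> R) (s : R) :
  u n @[n --> \oo] --> s -> weak_cvg (fun n => N (u n)) (N s).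
Proof.
move=> us g cg [K gK].
have mg : measurable_fun [set: measurableTypeR R] (EFin \o g).
  by apply/measurable_EFinP; exact: continuous_measurable_fun.
have E t : (\int[N t]_x (g x)%:E = \int[N 1]_x (g (t * x))%:E)%E.
  apply/esym/(@integral_law _ _ _ _ _ (N 1) (N t) (fun x => t * x) _ _ (EFin \o g)) => //.
    exact: measurable_funM.
  by move=> B mB; exact: centered_normal_scale.
rewrite E; under eq_fun do rewrite E.
have mgt (t : R) : measurable_fun [set: measurableTypeR R] (fun x => (g (t * x))%:E).
  have mt : measurable_fun [set: measurableTypeR R]
    (fun x : measurableTypeR R => t * x : measurableTypeR R) by exact: measurable_funM.
  exact: (measurableT_comp mg mt).
have [|||||//] := @dominated_convergence _ _ _ (N 1) setT measurableT
  (fun n x => (g (u n * x))%:E) (fun x => (g (s * x))%:E) (cst K%:E).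
- by move=> n; exact: mgt.
- exact: mgt.
- apply/aeW => x _; apply/cvg_EFin; first exact: nearW.
  apply: (cvg_comp (fun n => u n * x)); last exact: cg.
  by apply: cvgM => //; exact: cvg_cst.
- exact: finite_measure_integrable_cst.
- by apply/aeW => x n _ /=; rewrite lee_fin.
Qed.

End normal_uniqueness.

Section posterior_law.
Context {R : realType} {V2 Vb : hilbertType R}.
Context d (Omega : measurableType d) (P : probability Omega R).
Variables (T : {linear Vb -> V2}) (Ts : V2 -> Vb) (W : V2 -> {RV P >-> R}).
Variables (f0 : Vb) (Pi : probability (borel Vb) R) (eps : R) (q : Vb -> Omega -> R).
Hypothesis sepVb : separable Vb.
Hypothesis W_noise : white_noise W.
Hypothesis TsE : forall f y, inner (T f) y = inner f (Ts y).
Hypothesis Pi_gaussian : gaussian_centered Pi.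
Hypothesis eps_gt0 : 0 < eps.
Hypothesis mq : measurable_fun [set: borel Vb * Omega] (fun x => q x.1 x.2).
Hypothesis q_ge0 : forall f w, 0 <= q f w.
Hypothesis qE : forall f, {ae P, forall w,
  q f w = likelihood T eps (observation T W f0 eps w) f}.

Local Notation M w := (observation T W f0 eps w).
Let mq1 w : measurable_fun [set: borel Vb] (fun f : borel Vb => q f w).
Proof. exact: (measurable_fun_pair1 w mq). Qed.

Let mTinner y : measurable_fun [set: borel Vb] (fun f : borel Vb => inner (T f) y).
Proof.
by rewrite (_ : (fun _ => _) = fun f : borel Vb => inner (f : Vb) (Ts y));
  [exact: measurable_inner|apply/funext => f; rewrite TsE].
Qed.

Let post w : probability (borel Vb) R :=
  mnormalize (density_measure Pi (fun f : borel Vb => q f w)) Pi.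
Let Z w := (\int[Pi]_f (q f w)%:E)%E.

Lemma ge0_integral_posterior w (F : borel Vb -> \bar R) :
  (0 < Z w)%E -> (Z w < +oo)%E ->
  measurable_fun setT F -> (forall f, 0 <= F f)%E ->
  (\int[post w]_f F f = (fine (Z w))^-1%:E * \int[Pi]_f (F f * (q f w)%:E))%E.
Proof.
move=> Z0 Zoo mF F0.
have fZ : Z w \is a fin_num by rewrite ge0_fin_numE// ltW.
have z0 : 0 < fine (Z w) by apply: fine_gt0; rewrite Z0.
have zV : 0 <= (fine (Z w))^-1 by rewrite invr_ge0 ltW.
have dE (B : set (borel Vb)) : density_measure Pi (fun f : borel Vb => q f w) B =
    (\int[Pi]_(f in B) (q f w)%:E)%E.
  by rewrite /density_measure; case: pselect => // -[].
have mqE (B : set (borel Vb)) : measurable_fun B (fun f : borel Vb => (q f w)%:E).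
  by apply/measurable_funTS/measurable_EFinP.
rewrite (@ge0_integral_density _ _ _ Pi _ (fun f : borel Vb => (fine (Z w))^-1 * q f w))//.
- rewrite -ge0_integralZl//; last 2 first.
  + by apply: emeasurable_funM.
  + by move=> f _; rewrite mule_ge0// lee_fin.
  by apply: eq_integral => f _; rewrite EFinM muleCA.
- exact: measurable_funM.
- by move=> f; rewrite mulr_ge0.
move=> B mB; have E1 : (density_measure Pi (fun f : borel Vb => q f w)
  : {measure set (borel Vb) -> \bar R}) setT = Z w by exact: dE.
rewrite /post /= mnormalizeE ?E1//.
transitivity ((\int[Pi]_(f in B) (q f w)%:E) * (fine (Z w))^-1%:E)%E.
  by congr (_ * _)%E; exact: dE.
under [RHS]eq_integral do rewrite EFinM.
rewrite ge0_integralZl//; first by rewrite muleC.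
by move=> f _; rewrite lee_fin.
Qed.

(** [mean] is a choice with default 0, so a witness is needed: once the first moment is finite, the
    functional sending [h] to the integral of [<f, h>] is bounded and Riesz's theorem represents
    it. *)
Lemma posterior_is_mean : {ae P, forall w, is_mean (post w) (mean (post w))}.
Proof.
apply: filterS2 (evidence_gt0 Pi mq q_ge0 qE)
  (likelihood_first_moment_lty sepVb W_noise TsE Pi_gaussian eps_gt0 mq q_ge0 qE) => w Z0 H.
have mqE : measurable_fun [set: borel Vb] (fun f : borel Vb => (q f w)%:E).
  exact/measurable_EFinP.
have mH : measurable_fun [set: borel Vb] (fun f : borel Vb => ((1 + `|(f : Vb)|) * q f w)%:E).
  apply/measurable_EFinP/measurable_funM => //; apply: measurable_funD => //.
  exact: measurable_hnorm.
have mn : measurable_fun [set: borel Vb] (fun f : borel Vb => (`|(f : Vb)|)%:E).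
  by apply/measurable_EFinP; exact: measurable_hnorm.
have Zoo : (Z w < +oo)%E.
  apply: le_lt_trans H; apply: ge0_le_integral => //.
  - by move=> f _; rewrite lee_fin.
  - by move=> f _; rewrite lee_fin ler_peMl// lerDl.
have n1 : (\int[post w]_f (`|(f : Vb)|)%:E < +oo)%E.
  rewrite ge0_integral_posterior// lte_mul_pinfty//.
    by rewrite lee_fin invr_ge0 fine_ge0// ltW.
  apply: le_lt_trans H; apply: ge0_le_integral => //.
  - by move=> f _; rewrite mule_ge0// lee_fin.
  - exact: emeasurable_funM.
  - by move=> f _; rewrite -EFinM lee_fin ler_wpM2r// lerDr.
suff : exists m, is_mean (post w) m by move=> h; exact: (xgetPex 0 h).
have mi h : measurable_fun [set: borel Vb] (fun f : borel Vb => (inner (f : Vb) h)%:E).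
  by apply/measurable_EFinP; exact: measurable_inner.
have ni : (post w).-integrable [set: borel Vb] (fun f : borel Vb => (`|(f : Vb)|)%:E).
  by apply/integrableP; split => //; under eq_integral do rewrite gee0_abs//.
have ii h : (post w).-integrable [set: borel Vb] (fun f : borel Vb => (inner (f : Vb) h)%:E).
  have := integrableZl measurableT `|h| ni.
  apply: le_integrable => // f _; rewrite -EFinM lee_fin.
  by rewrite (ger0_norm (mulr_ge0 _ _))// mulrC norm_inner_le.
pose F h := fine (\int[post w]_f (inner (f : Vb) h)%:E)%E.
have FE h : (\int[post w]_f (inner (f : Vb) h)%:E = (F h)%:E)%E.
  by rewrite fineK// integrable_fin_num.
have [] := @riesz_representation _ _ F (fine (\int[post w]_f (`|(f : Vb)|)%:E)%E).
- move=> a b; apply: EFin_inj; rewrite EFinD -!FE -integralD//.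
  by apply: eq_integral => f _; rewrite innerDr.
- move=> a b; apply: EFin_inj; rewrite EFinM -!FE -integralZl//.
  by apply: eq_integral => f _; rewrite innerZr.
- move=> h; rewrite -lee_fin -abse_EFin -FE; apply: le_trans (le_abse_integral _ measurableT _) _ => //.
  rewrite EFinM fineK; last exact: integrable_fin_num.
  rewrite muleC -ge0_integralZl//.
  apply: ge0_le_integral => //.
  - exact: measurableT_comp.
  - exact: measurable_funeM.
  - by move=> f _; rewrite -EFinM lee_fin mulrC norm_inner_le.
by move=> m mE; exists m; split => // h; rewrite FE mE.
Qed.

(** The moment of order [a] of the rescaled functional is the posterior exponential moment at
    [s = - a / eps]. The part of its exponent linear in [M w (T v)] cancels the centring, and the
    quadratic part is [a^2 / 2] times the variance. The sign is that of the functional [<., psi>],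
    which equals [- <T f, g>]. *)
Lemma posterior_functional_law (y g : V2) (v : Vb) :
  (forall a, inner v a = cov Pi (Ts y) a) -> g = T v + eps ^+ 2 *: y ->
  {ae P, forall w, forall B : set (measurableTypeR R), measurable B ->
    post w ((fun f : borel Vb => eps^-1 * (M w (T v) - inner (T f) g)) @^-1` B) =
    centered_normal (Num.sqrt (`|T v| ^+ 2 + eps ^+ 2 * cov Pi (Ts y) (Ts y))) B}.
Proof.
move=> vE gE; have e0 : eps != 0 by rewrite gt_eqF.
set var := `|T v| ^+ 2 + _.
have var0 : 0 <= var.
  by rewrite addr_ge0 ?sqr_ge0// mulr_ge0 ?sqr_ge0 ?cov_ge0//; exact: gaussian_norm_sqr_lty.
(* Rational exponents are enumerated by naturals to collect their exceptional sets in a single null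
   set; a number coding no rational imposes nothing. *)
have mom : {ae P, forall w, forall n : nat, forall a : rat, unpickle n = Some a ->
  (\int[Pi]_f (expR (- ratr a / eps * inner (T f) g) * q f w)%:E =
    (expR (- ratr a / eps * M w (T v) + (- ratr a / eps) ^+ 2 * eps ^+ 2 * var / 2))%:E *
    Z w)%E}.
  apply: ae_foralln => n; case: (unpickle n) => [b|]; last exact/aeW.
  apply: filterS (likelihood_exp_moment sepVb W_noise TsE Pi_gaussian eps_gt0 mq q_ge0 qE
    (- ratr b / eps) vE gE) => w + a [<-]; exact.
apply: filterS3 (evidence_gt0 Pi mq q_ge0 qE)
  (likelihood_first_moment_lty sepVb W_noise TsE Pi_gaussian eps_gt0 mq q_ge0 qE) mom
  => w Z0 H {}mom.
have mqE : measurable_fun [set: borel Vb] (fun f : borel Vb => (q f w)%:E).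
  exact/measurable_EFinP.
have mH : measurable_fun [set: borel Vb] (fun f : borel Vb => ((1 + `|(f : Vb)|) * q f w)%:E).
  apply/measurable_EFinP/measurable_funM => //; apply: measurable_funD => //.
  exact: measurable_hnorm.
have Zoo : (Z w < +oo)%E.
  apply: le_lt_trans H; apply: ge0_le_integral => //.
  - by move=> f _; rewrite lee_fin.
  - by move=> f _; rewrite lee_fin ler_peMl// lerDl.
have fZ : Z w \is a fin_num by rewrite ge0_fin_numE// ltW.
have z0 : fine (Z w) != 0 by rewrite gt_eqF//; apply: fine_gt0; rewrite Z0.
set Y := fun f : borel Vb => _.
have mY : measurable_fun [set: borel Vb] (Y : borel Vb -> measurableTypeR R).
  by apply: measurable_funM => //; apply: measurable_funB.
move=> B mB; apply: (@normal_law_unique R _ _ (post w) Y) => // a.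
have mYe : measurable_fun setT (fun f : borel Vb => (expR (ratr a * Y f))%:E).
  by apply/measurable_EFinP; apply: measurableT_comp => //; exact: measurable_funM.
rewrite ge0_integral_posterior//.
transitivity ((fine (Z w))^-1%:E * \int[Pi]_f ((expR (ratr a * eps^-1 * M w (T v)))%:E *
    (expR (- ratr a / eps * inner (T f) g) * q f w)%:E))%E.
  congr (_ * _)%E; apply: eq_integral => f _; rewrite -!EFinM [in RHS]mulrA -expRD.
  by congr (expR _ * _)%:E; rewrite /Y; ring.
rewrite ge0_integralZl//; last 2 first.
- apply/measurable_EFinP/measurable_funM => //; apply: measurableT_comp => //.
  exact: measurable_funM.
- by move=> f _; rewrite lee_fin mulr_ge0 ?expR_ge0.
rewrite (mom (pickle a) a (pickleK a)) -(fineK fZ) -!EFinM.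
set e1 := expR _; set e2 := expR _.
have -> : (fine (Z w))^-1 * (e1 * (e2 * fine (Z w))) = e1 * e2 by field.
rewrite /e1 /e2 -expRD sqr_sqrtr//; congr (expR _)%:E.
by field.
Qed.

End posterior_law.

(** * Asymptotics *)

Section posterior_mean_functional.
Context {R : realType} {V2 Vb : hilbertType R}.
Variables (T : {linear Vb -> V2}) (Ts : V2 -> Vb).
Hypothesis TsE : forall f y, inner (T f) y = inner f (Ts y).

Lemma mean_of_normal_functional (mu : probability (borel Vb) R) (m : Vb) (g : V2) (eps b s : R) :
  0 < eps -> is_mean mu m ->
  (forall B : set (measurableTypeR R), measurable B ->
    mu ((fun f : borel Vb => eps^-1 * (b - inner (T f) g)) @^-1` B) = centered_normal s B) ->
  inner (T m) g = b.
Proof.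
move=> eps0 [_ mE] hY; set Y := fun f : borel Vb => _ in hY.
have mY : measurable_fun [set: borel Vb] (Y : borel Vb -> measurableTypeR R).
  apply: measurable_funM => //; apply: measurable_funB => //.
  rewrite (_ : (fun _ => _) = fun f : borel Vb => inner (f : Vb) (Ts g)).
    exact: measurable_inner.
  by apply/funext => f; rewrite TsE.
have [iN EN] := centered_normal_mean s.
have mid : measurable_fun [set: measurableTypeR R] (fun x : measurableTypeR R => x%:E : \bar R).
  exact/measurable_EFinP.
pose N := centered_normal s : probability (measurableTypeR R) R.
have EY : (\int[mu]_f (Y f)%:E = 0)%E.
  by rewrite (@integral_law _ _ _ _ _ mu N Y mY hY (fun x => x%:E)).
have iY : mu.-integrable setT (fun f => (Y f)%:E).
  by apply/(@integrable_law _ _ _ _ _ mu N Y mY hY (fun x => x%:E)).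
rewrite TsE; apply: EFin_inj; rewrite -mE.
transitivity (\int[mu]_f (b%:E - eps%:E * (Y f)%:E))%E.
  apply: eq_integral => f _; rewrite -EFinM -EFinB; congr EFin.
  by rewrite /Y TsE; field; rewrite gt_eqF.
have ib : mu.-integrable setT (cst b%:E : borel Vb -> \bar R).
  exact: finite_measure_integrable_cst.
rewrite integralB//; last exact: integrableZl.
rewrite integralZl// EY mule0 sube0 integral_cst//.
by rewrite (_ : (mu : {measure set _ -> \bar R}) setT = 1%E) ?mule1//; exact: probability_setT.
Qed.

End posterior_mean_functional.

(** * The RKHS and the concentration condition *)

Section rkhs_theory.
Context {R : realType} {V : hilbertType R}.
Variable mu : probability (borel V) R.
Hypothesis mu2 : (\int[mu]_f (`|(f : V)| ^+ 2)%:E < +oo)%E.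

(** Young's inequality under the integral that represents [g], with [kappa] the squared norm of the
    representer. In this additive form the covariance term can be absorbed by the regularized
    equation. *)
Lemma rkhs_inner_le g : rkhs mu g ->
  exists2 kappa : R, 0 <= kappa & forall h, 2 * `|inner g h| <= kappa + cov mu h h.
Proof.
move=> [k [[mk k2 _] kE]].
have mk2 : measurable_fun [set: borel V] (fun f => (k f ^+ 2)%:E).
  by apply/measurable_EFinP/measurable_funX.
have k20 : (0 <= \int[mu]_f (k f ^+ 2)%:E)%E.
  by apply: integral_ge0 => f _; rewrite lee_fin sqr_ge0.
have fk : (\int[mu]_f (k f ^+ 2)%:E)%E \is a fin_num by rewrite ge0_fin_numE.
exists (fine (\int[mu]_f (k f ^+ 2)%:E)%E); first exact: fine_ge0.
move=> h; rewrite -lee_fin EFinD fineK// -covE// EFinM -abse_EFin -kE.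
have mkh : measurable_fun [set: borel V] (fun f => (k f * inner (f : V) h)%:E).
  by apply/measurable_EFinP/measurable_funM => //; exact: measurable_inner.
have mkh2 : measurable_fun [set: borel V] (fun f => `|(k f * inner (f : V) h)%:E|%E).
  exact: measurableT_comp.
apply: (@le_trans _ _ (2%:E * \int[mu]_f `|(k f * inner (f : V) h)%:E|)%E).
  by apply: lee_wpmul2l => //; exact: le_abse_integral.
rewrite -ge0_integralZl// -ge0_integralD//; last 3 first.
- by move=> f _; rewrite lee_fin sqr_ge0.
- by move=> f _; rewrite lee_fin -expr2 sqr_ge0.
- exact: measurable_inner_prod.
apply: ge0_le_integral => //.
- exact: measurable_funeM.
- by apply: emeasurable_funD => //; exact: measurable_inner_prod.
move=> f _; rewrite abse_EFin -EFinM -EFinD lee_fin.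
set a := k f; set b := inner _ _; rewrite normrM.
rewrite -expr2 -[a ^+ 2]real_normK ?num_real// -[b ^+ 2]real_normK ?num_real//.
by have := sqr_ge0 (`|a| - `|b|); nra.
Qed.

(** If no element of the RKHS were within the radius of [f0], the infimum would be [+oo]; as minus
    the logarithm of a probability is nonnegative, so would be the concentration function, against
    its finite bound. The radii tend to 0. *)
Lemma concentration_closure f0 c : 0 < c -> concentration_condition mu f0 c ->
  forall e, 0 < e -> exists2 g, rkhs mu g & `|g - f0| <= e.
Proof.
move=> c0 [delta [d0 _ hd]] e e0.
have c20 : 0 < 2 * c by rewrite mulr_gt0.
have dle : \forall eps \near 0^'+, delta eps / (2 * c) <= e.
  have ec : 0 < e * (2 * c) by rewrite mulr_gt0.
  move/cvgr_le : d0 => /(_ _ ec); apply: filterS => t h.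
  by rewrite ler_pdivrMr.
have [t [ht dt]] : exists t, (concentration_fun mu f0 (delta t / (2 * c)) <=
    ((delta t / t) ^+ 2)%:E)%E /\ delta t / (2 * c) <= e.
  have : \forall eps \near 0^'+, (concentration_fun mu f0 (delta eps / (2 * c)) <=
    ((delta eps / eps) ^+ 2)%:E)%E /\ delta eps / (2 * c) <= e by exact: filterI.
  by move=> /(@filter_ex _ _ (at_right_proper_filter 0))[t [h1 h2]]; exists t.
move: ht; rewrite /concentration_fun.
set S := rkhs mu `&` _; have [S0|/set0P[g [rg /= gd]] _] := eqVneq S set0; last first.
  by exists g => //; exact: le_trans dt.
rewrite S0 image_set0 ereal_inf0.
have mS : measurable [set f : borel V | `|(f : V)| <= delta t / (2 * c)].
  have := @measurable_hnorm R V measurableT _ (measurable_itv `]-oo, delta t / (2 * c)]).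
  by rewrite setTI; congr measurable; apply/seteqP; split => x /=; rewrite in_itv.
have : (lne (mu [set f : borel V | (`|(f : V)| <= delta t / (2 * c))%R]) <= 0)%E.
  by rewrite lne_le0 probability_le1.
by case: (lne _).
Qed.

End rkhs_theory.

Section outer_measure_ae.
Context d (T : measurableType d) (R : realType) (P : probability T R).

(** Handles events involving the posterior mean or a metric, whose measurability is not established:
    only the dominating event [B] has to be measurable. *)
Lemma mu_ext_ae_le (A B : set T) : measurable B -> {ae P, forall w, A w -> B w} ->
  (mu_ext P A <= P B)%E.
Proof.
move=> mB [N [mN N0 AN]].
apply: (@le_trans _ _ (mu_ext P (N `|` B))).
  apply: le_mu_ext => w Aw; have [Bw|nBw] := pselect (B w); [by right|left].
  by apply: AN => /= /(_ Aw).
rewrite measurable_mu_extE; last exact: measurableU.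
apply: le_trans (measureU2 _ _ _) _ => //.
by move: N0 => /= N0; rewrite [X in (X + _)%E]N0 add0e.
Qed.

End outer_measure_ae.

Lemma chebyshev_sqr d (T : measurableType d) (R : realType) (P : probability T R)
    (X : T -> R) (t : R) : measurable_fun setT X -> 0 < t ->
  (P [set w | (t <= `|X w|)%R] <= (t ^- 2)%:E * \int[P]_w (X w ^+ 2)%:E)%E.
Proof.
move=> mX t0; set A := [set w | _].
have mA : measurable A.
  have mnX : measurable_fun setT (fun w => `|X w|) by exact: measurableT_comp.
  have := mnX measurableT _ (measurable_itv `[t, +oo[).
  by rewrite setTI; congr measurable; apply/seteqP; split => x /=; rewrite in_itv/= andbT.
have mX2 (D : set T) : measurable_fun D (fun w => (X w ^+ 2)%:E).
  by apply/measurable_funTS/measurable_EFinP; exact: measurable_funX.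
have X20 (D : set T) w : D w -> (0 <= (X w ^+ 2)%:E)%E by rewrite lee_fin sqr_ge0.
have t2 : 0 < t ^+ 2 by rewrite exprn_gt0.
rewrite -[leLHS]mul1e -(mulVf (lt0r_neq0 t2)) EFinM -muleA; apply: lee_wpmul2l.
  by rewrite lee_fin invr_ge0 ltW.
apply: (@le_trans _ _ (\int[P]_(w in A) (X w ^+ 2)%:E)%E).
  rewrite -integral_cst//; apply: ge0_le_integral => //.
  - by move=> w _; rewrite lee_fin ltW.
  move=> w /= tw; rewrite lee_fin -[leRHS]real_normK ?num_real//.
  by apply: lerXn2r; rewrite ?nnegrE ?(ltW t0).
by apply: ge0_subset_integral => //; exact: X20.
Qed.

(** Two continuous extensions differ on an open set that misses the dense range of [iota], so the
    choice made by [xget] is forced. *)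
Lemma inner_extE (R : realType) (V Vb : hilbertType R) (iota : V -> Vb) (psi : V)
    (L : Vb -> R) : dense (range iota) -> continuous L ->
  (forall phi, L (iota phi) = inner phi psi) -> inner_ext iota psi = L.
Proof.
move=> dV cL LE; rewrite /inner_ext.
have [cL' L'E] : [set L0 : Vb -> R | continuous L0 /\
    forall phi, L0 (iota phi) = inner phi psi] (xget (cst 0) [set L0 : Vb -> R | continuous L0 /\
    forall phi, L0 (iota phi) = inner phi psi]).
  by apply: xgetPex; exists L.
set L' := xget _ _ in cL' L'E *.
apply/funext => f; apply/eqP; apply/negPn/negP => ne.
have oU : open [set h | L' h != L h].
  rewrite (_ : [set h | _] = (fun h => L' h - L h) @^-1` [set x | x != 0]).
    apply: open_comp; last exact: open_neq.
    by move=> x _; apply: (@cvgB _ R^o); [exact: cL'|exact: cL].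
  by apply/seteqP; split => h /=; rewrite subr_eq0.
have [] := dV _ (ex_intro _ f ne) oU.
by move=> _ [/[swap] [[phi _ <-]]] /=; rewrite L'E LE eqxx.
Qed.

Section regularization_bias.
Context {R : realType} {V2 Vb : hilbertType R}.
Variables (T : {linear Vb -> V2}) (c : R) (Ts : V2 -> Vb) (Pi : probability (borel Vb) R).
Hypothesis c_gt0 : 0 < c.
Hypothesis T_bound : forall f, `|T f| <= c * `|f|.
Hypothesis TsE : forall f y, inner (T f) y = inner f (Ts y).
Hypothesis Pi2 : (\int[Pi]_f (`|(f : Vb)| ^+ 2)%:E < +oo)%E.
Variable psit : Vb.
Hypothesis psit_rkhs : rkhs Pi psit.

(* [y = (T Q T* + eps ^+ 2)^-1 (T psit)], with [Q] the covariance operator. *)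
Definition regularized_solution (eps : R) (y : V2) :=
  forall h, eps ^+ 2 * inner y h + cov Pi (Ts y) (Ts h) = inner (T psit) h.

(** Test the equation with [y] itself: [eps^2 |y|^2 + cov (Ts y) (Ts y) = <psit, Ts y>], and the
    right side is at most [(kappa + cov (Ts y) (Ts y)) / 2]. Half of the covariance is absorbed on
    the left. The 1 in [K] passes from the bound on [(eps |y|)^2] to one on [eps |y|]. *)
Lemma regularized_bound : exists2 K : R, 0 <= K & forall eps y, 0 < eps ->
  regularized_solution eps y -> eps * `|y| <= K /\ cov Pi (Ts y) (Ts y) <= K.
Proof.
have [kappa kappa0 kE] := rkhs_inner_le Pi2 psit_rkhs.
exists (1 + kappa) => [|eps y eps0 yE]; first by rewrite addr_ge0.
have := yE y; rewrite TsE inner_sqnorm => E.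
have := kE (Ts y); have := ler_norm (inner psit (Ts y)).
have C0 := cov_ge0 Pi2 (Ts y); have ey0 : 0 <= eps * `|y| by rewrite mulr_ge0// ltW.
have := sqr_ge0 (eps * `|y| - 1); have := sqr_ge0 (eps * `|y|).
by split; nra.
Qed.

(** Replace [f0] by a nearby [f1] in the RKHS. For [f1] the pairing with [Ts y] is bounded
    independently of [eps], so its contribution is [O(eps)]; the error [f1 - f0] is multiplied by
    [eps |y|], which is bounded. *)
Lemma regularized_bias_cvg0 f0 : concentration_condition Pi f0 c ->
  forall eta : R, 0 < eta -> \forall eps \near 0^'+, forall y,
    regularized_solution eps y -> `|eps * inner (T f0) y| <= eta.
Proof.
move=> conc eta eta0; have [K K0 yK] := regularized_bound.
have K1 : 0 < K + 1 by rewrite ltr_wpDl.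
(* With this distance from [f1] to [f0], the approximation error costs at most [eta / 2]; [K + 1]
   replaces [K] to have a positive denominator. *)
have e0 : 0 < eta / (2 * (c * (K + 1))) by rewrite divr_gt0// !mulr_gt0.
have [f1 f1r f1E] := concentration_closure c_gt0 conc e0.
have [k1 k10 k1E] := rkhs_inner_le Pi2 f1r.
have kK : 0 < k1 + K + 1 by rewrite ltr_wpDl// addr_ge0.
near=> eps => y yE.
have eps0 : 0 < eps by near: eps; exact: nbhs_right_gt.
have epsl : eps * (k1 + K + 1) < eta.
  rewrite -ltr_pdivlMr//; near: eps; apply: nbhs_right_lt; exact: divr_gt0.
have [ey cy] := yK _ _ eps0 yE.
have -> : eps * inner (T f0) y = eps * inner f1 (Ts y) - eps * inner (T (f1 - f0)) y.
  by rewrite !TsE innerBl; ring.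
apply: le_trans (ler_normB _ _) _; rewrite !normrM (ger0_norm (ltW eps0)).
have h1 := k1E (Ts y).
have h2 : `|inner (T (f1 - f0)) y| <= c * (eta / (2 * (c * (K + 1)))) * `|y|.
  apply: le_trans (norm_inner_le _ _) _; apply: ler_wpM2r => //.
  by apply: le_trans (T_bound _) _; rewrite ler_wpM2l// ltW.
have h3 : c * (eta / (2 * (c * (K + 1)))) * (K + 1) = eta / 2.
  by field; rewrite !gt_eqF.
have h4 : 0 <= c * (eta / (2 * (c * (K + 1)))) by rewrite mulr_ge0// ltW.
have h5 : eps * `|inner (T (f1 - f0)) y| <= eta / 2.
  rewrite -h3; apply: (@le_trans _ _ (c * (eta / (2 * (c * (K + 1)))) * (eps * `|y|))).
    by rewrite mulrCA ler_wpM2l// ltW.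
  by apply: ler_wpM2l => //; rewrite (le_trans ey)// lerDl.
have h6 : eps * `|inner f1 (Ts y)| <= eta / 2.
  have : eps * (2 * `|inner f1 (Ts y)|) <= eps * (k1 + K).
    by apply: ler_wpM2l; [exact: ltW|exact: le_trans h1 (lerD (lexx _) cy)].
  by nra.
by rewrite (splitr eta) lerD.
Unshelve. all: by end_near. Qed.

Lemma regularized_variance eps y v : 0 < eps -> regularized_solution eps y ->
  (forall a, inner v a = cov Pi (Ts y) a) ->
  T psit = T v + eps ^+ 2 *: y /\
  `|T v| ^+ 2 + eps ^+ 2 * cov Pi (Ts y) (Ts y) = `|T psit| ^+ 2 - eps ^+ 2 * inner y (T psit).
Proof.
move=> eps0 yE vE.
have gE : T psit = T v + eps ^+ 2 *: y.
  by apply: inner_ext_eq => h; rewrite -yE innerDl innerZl (TsE v) vE addrC.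
split => //; have Ey := yE y; rewrite gE in Ey *.
rewrite sqnormD normrZ exprMn real_normK ?num_real// !innerZr innerDr innerZr.
move: Ey; rewrite inner_sqnorm innerDl innerZl inner_sqnorm (innerC y (T v)).
by move=> Ey; nra.
Qed.

End regularization_bias.

(** An arbitrary metric for weak convergence is controlled only along sequences, so continuity in
    the variance is proved by contradiction, with a sequence of bad variances at distance below
    [1/(n+1)]. *)
Lemma weak_metric_normal (R : realType)
    (dist : probability (measurableTypeR R) R -> probability (measurableTypeR R) R -> R) (s eta : R) :
  weak_metric dist -> 0 < eta -> exists2 e : R, 0 < e & forall t, `|t - s| < e ->
    dist (centered_normal (Num.sqrt t)) (centered_normal (Num.sqrt s)) < eta.
Proof.
move=> [_ _ _ _ dP] eta0; apply: contrapT => H.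
have /choice[u uE] n : exists t : R, `|t - s| < n.+1%:R^-1 /\
    eta <= dist (centered_normal (Num.sqrt t)) (centered_normal (Num.sqrt s)).
  apply: contrapT => Hn; apply: H; exists n.+1%:R^-1; first by rewrite invr_gt0.
  by move=> t ts; rewrite ltNge; apply/negP => h; apply: Hn; exists t.
have us : u n @[n --> \oo] --> s.
  apply/cvgrPdist_lt => e e0; have := near_infty_natSinv_lt (PosNum e0).
  by apply: filterS => n; rewrite distrC; apply: lt_trans; exact: (uE n).1.
have : dist (centered_normal (Num.sqrt (u n))) (centered_normal (Num.sqrt s)) @[n --> \oo] --> 0.
  apply/dP/weak_cvg_centered_normal.
  by apply: continuous_cvg => //; exact: sqrt_continuous.
move=> /cvgr_lt/(_ _ eta0)/filter_ex[n]; rewrite ltNge => /negP; apply.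
exact: (uE n).2.
Qed.

Section law_facts.
Context {R : realType} d (T : measurableType d) (mu : probability T R).

Lemma lawE (X : T -> measurableTypeR R) (B : set (measurableTypeR R)) :
  measurable_fun setT X -> law mu X B = mu (X @^-1` B).
Proof. by move=> mX; rewrite /law; case: pselect => // mX'. Qed.

End law_facts.

Section posterior_mean_error.
Context {R : realType} {V2 Vb : hilbertType R}.
Context d (Omega : measurableType d) (P : probability Omega R).
Variables (T : {linear Vb -> V2}) (Ts : V2 -> Vb) (W : V2 -> {RV P >-> R}).
Variables (f0 : Vb) (Pi : probability (borel Vb) R) (eps : R) (p : R -> Vb -> Omega -> R).
Hypothesis sepVb : separable Vb.
Hypothesis W_noise : white_noise W.
Hypothesis TsE : forall f y, inner (T f) y = inner f (Ts y).
Hypothesis Pi_gaussian : gaussian_centered Pi.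
Hypothesis p_version : likelihood_version T W f0 p.
Hypothesis eps_gt0 : 0 < eps.
Variables (psit : Vb) (y : V2).
Hypothesis yE : regularized_solution T Ts Pi psit eps y.
Let g := T psit.
Let post := posterior Pi p eps.

(** The posterior functional has mean [M w (T v)], and [T v] differs from [g] by [eps^2 y];
    linearity of the noise at this one decomposition gives the error. Both identities are exact at
    each [eps], and limits enter only afterwards. *)
Lemma posterior_mean_error : {ae P, forall w,
  eps^-1 * (inner (T f0) g + eps * W g w - inner (T (mean (post w))) g) =
    eps * inner (T f0) y + eps ^+ 2 * W y w /\
  forall B : set (measurableTypeR R), measurable B ->
    law (post w) (fun f : borel Vb => eps^-1 * (inner (T (mean (post w))) g - inner (T f) g)) B =
    centered_normal (Num.sqrt (`|g| ^+ 2 - eps ^+ 2 * inner y g)) B}.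
Proof.
have [mq q0 qE] := p_version eps_gt0.
have Pi2 := gaussian_norm_sqr_lty sepVb Pi_gaussian.
have [v vE] := cov_riesz Pi2 (Ts y).
have [gE varE] := regularized_variance TsE eps_gt0 yE vE.
apply: filterS3 (posterior_is_mean sepVb W_noise TsE Pi_gaussian eps_gt0 mq q0 qE)
  (posterior_functional_law sepVb W_noise TsE Pi_gaussian eps_gt0 mq q0 qE vE gE)
  (white_noise_linear W_noise (T v) y (eps ^+ 2)).
move=> w hm; rewrite varE => hY hW.
have mE : inner (T (mean (post w))) g = observation T W f0 eps w (T v).
  exact: (mean_of_normal_functional (mu := post w) TsE eps_gt0 hm hY).
split.
  rewrite mE /observation /g gE hW innerDr innerZr.
  by field; rewrite gt_eqF.
move=> B mB; rewrite lawE; first by rewrite mE; exact: hY.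
apply: measurable_funM => //; apply: measurable_funB => //.
rewrite (_ : (fun _ => _) = fun f : borel Vb => inner (f : Vb) (Ts g)).
  exact: measurable_inner.
by apply/funext => f; rewrite TsE.
Qed.

End posterior_mean_error.

Theorem corollary3 (R : realType) (W1 W2 Wb : hilbertType R)
  (sepW1 : separable W1) (sepW2 : separable W2) (sepWb : separable Wb)
  (A : {linear W1 -> W2}) (A_bounded : continuous A) (A_inj : injective A)
  (Astar : W2 -> W1)
  (A_adjoint : forall f g, inner (A f) g = inner f (Astar g))
  (iota : {linear W1 -> Wb}) (iota_inj : injective iota)
  (iota_dense : dense (range iota))
  (Ab : {linear Wb -> W2}) (Ab_continuous : continuous Ab)
  (Ab_ext : forall f, Ab (iota f) = A f)
  (c : R) (c_gt0 : 0 < c) (Ab_bound : forall f, `|Ab f| <= c * `|f|)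
  (d : measure_display) (Omega : measurableType d) (P : probability Omega R)
  (W : W2 -> {RV P >-> R}) (W_noise : white_noise W)
  (f0 : Wb) (p : R -> Wb -> Omega -> R)
  (p_version : likelihood_version Ab W f0 p)
  (Pi : probability (borel Wb) R) (Pi_gaussian : gaussian_centered Pi)
  (Pi_concentration : concentration_condition Pi f0 c)
  (psi : W1) (C : R) (C_gt0 : 0 < C)
  (psi_bound : forall phi, `|inner psi phi| <= C * `|iota phi|)
  (psit : Wb) (psit_rkhs : rkhs Pi psit) (psiE : psi = - Astar (Ab psit)) :
  let post := posterior Pi p in
  let fbar := fun eps w => mean (post eps w) in
  let L := inner_ext iota psi in
  let Psihat := fun eps w => L f0 - eps * W (Ab psit) w in
  cvg0_in_probability P
    (fun eps w => eps^-1 * (L (fbar eps w) - Psihat eps w)) /\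
  forall dist : probability (measurableTypeR R) R ->
                probability (measurableTypeR R) R -> R,
    weak_metric dist ->
    cvg0_in_probability P
      (fun eps w =>
         dist (law (post eps w)
                   (fun f : borel Wb => eps^-1 * (L f - L (fbar eps w))))
              (centered_normal `|Ab psit|)).
Proof.
move=> post fbar L Psihat.
have Pi2 := gaussian_norm_sqr_lty sepWb Pi_gaussian.
(* [Ts] is the adjoint for the inner product of [Wb], whereas [Astar] is the adjoint for that of
   [W1]; the latter enters only in identifying [L]. *)
have [Ts TsE] := adjoint_exists Ab_bound.
set g := Ab psit.
have LE : L = fun f => - inner (Ab f) g.
  apply: inner_extE => // [f|phi].
    rewrite (_ : (fun _ => _) = fun f => - inner f (Ts g)).
      by apply: (@cvgN _ R^o); exact: continuous_innerl.
    by apply/funext => h; rewrite TsE.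
  by rewrite Ab_ext A_adjoint psiE innerNr.
have c_ge0 := ltW c_gt0.
have [K K0 yK] := regularized_bound TsE Pi2 psit_rkhs.
split.
- move=> eta eta0; have eta20 : 0 < eta / 2 by rewrite divr_gt0.
  (* Once the bias is below [eta / 2], an error of size [eta] forces the noise term to exceed
     [eta / 2]. Its second moment is [eps^4 |y|^2], at most [K^2 eps^2], and Chebyshev's inequality
     gives this upper bound. *)
  apply: (@squeeze_cvge _ _ _ _ (cst 0%E) _
      (fun eps => ((eta / 2) ^- 2 * (K ^+ 2 * eps ^+ 2))%:E)).
  + near=> eps; apply/andP; split; first exact: mu_ext_ge0.
    have eps0 : 0 < eps by near: eps; exact: nbhs_right_gt.
    have [y yE] := regularized_solve c_ge0 Ab_bound TsE Pi2 g eps0.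
    have bias : `|eps * inner (Ab f0) y| <= eta / 2.
      move: y yE; near: eps.
      exact: (regularized_bias_cvg0 c_gt0 Ab_bound TsE Pi2 psit_rkhs Pi_concentration).
    have mX : measurable_fun setT (fun w => eps ^+ 2 * W y w) by exact: measurable_funM.
    apply: (@le_trans _ _ (P [set w | eta / 2 <= `|eps ^+ 2 * W y w|])).
      apply: mu_ext_ae_le.
        have := measurableT_comp (@normr_measurable R setT) mX.
        move=> /(_ measurableT _ (measurable_itv `[eta / 2, +oo[)).
        by rewrite setTI; congr measurable; apply/seteqP; split => x /=; rewrite in_itv/= andbT.
      apply: filterS (posterior_mean_error sepWb W_noise TsE Pi_gaussian p_version eps0 yE).
      move=> w [E _] /=.
      rewrite /Psihat LE /fbar (_ : _ - _ = inner (Ab f0) g + eps * W g w -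
        inner (Ab (mean (post eps w))) g); last by rewrite /g; ring.
      rewrite E => h; have := ler_normD (eps * inner (Ab f0) y) (eps ^+ 2 * W y w).
      by lra.
    apply: le_trans (chebyshev_sqr P mX eta20) _.
    rewrite EFinM; apply: lee_wpmul2l.
      by rewrite lee_fin invr_ge0 exprn_ge0// ltW.
    have -> : (\int[P]_w ((eps ^+ 2 * W y w) ^+ 2)%:E = (eps ^+ 4 * `|y| ^+ 2)%:E)%E.
      rewrite EFinM -inner_sqnorm -(white_noise_inner W_noise) -ge0_integralZl//.
      * by apply: eq_integral => w _; rewrite -EFinM; congr EFin; ring.
      * by apply/measurable_EFinP/measurable_funM.
      * by move=> w _; rewrite lee_fin -expr2 sqr_ge0.
      * by rewrite lee_fin exprn_ge0// ltW.
    have [ey _] := yK _ _ eps0 yE.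
    rewrite lee_fin (_ : _ * _ = (eps * `|y|) ^+ 2 * eps ^+ 2); last by ring.
    by rewrite ler_wpM2r ?sqr_ge0// lerXn2r ?nnegrE// mulr_ge0// ltW.
  + exact: cvg_cst.
  + apply/cvg_EFin; first exact: nearW.
    rewrite [X in _ --> X](_ : _ = (eta / 2) ^- 2 * (K ^+ 2 * 0 ^+ 2)); last first.
      by rewrite expr0n/= !mulr0.
    apply: cvg_at_right_filter.
    by do 2! apply: cvgMl_tmp; exact: exprn_continuous.
move=> dist distM; have [dist0 distE distC distD _] := distM.
move=> eta eta0.
have [e e_gt0 e_lt] := weak_metric_normal (`|g| ^+ 2) distM eta0.
have Kg : 0 < K * `|g| + 1 by rewrite ltr_wpDl// mulr_ge0.
(* The outer measure is eventually 0, not merely small: outside a null set the posterior law is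
   exactly normal, with a variance that does not depend on the outcome. *)
apply: cvg_near_cst; near=> eps.
have eps0 : 0 < eps by near: eps; exact: nbhs_right_gt.
have [y yE] := regularized_solve c_ge0 Ab_bound TsE Pi2 g eps0.
have small : dist (centered_normal (Num.sqrt (`|g| ^+ 2 - eps ^+ 2 * inner y g)))
    (centered_normal `|g|) < eta.
  have gE : `|g| = Num.sqrt (`|g| ^+ 2) by rewrite sqrtr_sqr normr_id.
  rewrite [in X in dist _ X]gE; apply: e_lt.
  rewrite addrC addKr normrN normrM ger0_norm ?sqr_ge0//.
  have [ey _] := yK _ _ eps0 yE.
  apply: le_lt_trans (_ : eps * (K * `|g| + 1) < e); last first.
    by rewrite -ltr_pdivlMr//; near: eps; apply: nbhs_right_lt; exact: divr_gt0.
  rewrite expr2 -mulrA ler_wpM2l ?(ltW eps0)//.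
  apply: (@le_trans _ _ (eps * (`|y| * `|g|))).
    by rewrite ler_wpM2l ?(ltW eps0)// norm_inner_le.
  by rewrite mulrA (le_trans (ler_wpM2r _ ey))// lerDl.
apply/eqP; rewrite eq_le; apply/andP; split; last exact: mu_ext_ge0.
rewrite -[leRHS](measure0 P); apply: mu_ext_ae_le => //.
apply: filterS (posterior_mean_error sepWb W_noise TsE Pi_gaussian p_version eps0 yE).
move=> w [_ lE] /=; apply/negP; rewrite -ltNge ger0_norm//.
apply: le_lt_trans small.
apply: le_trans (distD _ (centered_normal (Num.sqrt (`|g| ^+ 2 - eps ^+ 2 * inner y g))) _) _.
(* The two probabilities are known to agree only on measurable sets, which is exactly when a metric
   for weak convergence vanishes. *)
rewrite gerDr le_eqVlt; apply/orP; left; apply/eqP/distE => B mB.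
rewrite -lE//; congr (law _ _ B).
by apply/funext => f; rewrite LE /fbar /post; ring.
Unshelve. all: by end_near. Qed.
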